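(* Let $K$ be a field, $1\le d\le n$, $S=K[x_1,\dots,x_n]$, and let $I=I_{n,d}\subset S$ be the squarefree Veronese ideal of degree $d$, i.e. the ideal generated by all squarefree monomials of degree $d$ in $S$. Then $\mathcal{R}_s(I)$ satisfies the $x$-condition with respect to the monomial order $>$ on $T=S[y_1,\dots,y_m]$ defined in the context.
   Context: $I^{(k)}=\bigcap_{P\in\mathrm{Ass}(I)}(I^kS_P\cap S)$ is the $k$th symbolic power and $\mathcal{R}_s(I)=\bigoplus_{k\ge0}I^{(k)}t^k\subset S[t]$ the symbolic Rees algebra. Let $w_1,\dots,w_m$ be the minimal monomial generators of $\mathcal{R}_s(I)$ as an $S$-algebra, labelled so that $w_1>\dots>w_m$, where $ut^p>vt^q$ iff $p>q$, or $p=q$ and $u>_{\mathrm{lex}}v$ (lexicographic order on $S$ with $x_1>\dots>x_n$). (It is known that $\mathcal{R}_s(I)$ is generated over $S$ by the monomials $x_{i_1}\cdots x_{i_{q+d-1}}t^q$ with $1\le q\le n-d+1$, $i_1<\dots<i_{q+d-1}$.) Let $T=S[y_1,\dots,y_m]$, $\varphi:T\to\mathcal{R}_s(I)$ the $S$-algebra map with $\varphi(y_i)=w_i$, and $J=\mathrm{Ker}\,\varphi$. Order on $T$: let $>_{\mathrm{rlex}}$ be the (degree) reverse lexicographic order on $K[y_1,\dots,y_m]$ with $y_1>\dots>y_m$. For monomials $g,g'$ in the $y$'s and $f,f'$ in the $x$'s, $gf>g'f'$ iff $g>_{\mathrm{rlex}}g'$, or $g=g'$ and $f>_{\mathrm{lex}}f'$.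 $\mathcal{R}_s(I)$ satisfies the $x$-condition with respect to this order if every minimal monomial generator of $\mathrm{in}_<(J)$ has the form $vv'$ with $v\in S$ a monomial of degree at most one and $v'\in K[y_1,\dots,y_m]$ a monomial. *)

(* Defs.v *)
From HB Require Import structures.
From mathcomp Require Import all_boot all_order all_algebra.
From mathcomp Require Import boolp classical_sets.
From mathcomp Require Import mpoly.

Set Implicit Arguments.
Unset Strict Implicit.
Unset Printing Implicit Defensive.

Import GRing.Theory.
Local Open Scope ring_scope.
Local Open Scope classical_set_scope.

Definition minimal_such (T : Type) (C : set T -> Prop) (G : set T) : Prop :=
  C G /\ forall G' : set T, G' `<=` G -> C G' -> G' = G.

Section Ideals.
Variable R : comNzRingType.
Implicit Types (A B P : set R) (f : R).

(* Unlike the library's idealr_closed, this allows the unit ideal. *)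
Definition is_ideal A : Prop :=
  A 0 /\ forall a u v, A u -> A v -> A (a * u + v).

Definition ideal_gen A : set R := smallest is_ideal A.

Definition ideal_mul A B : set R := ideal_gen [set a * b | a in A & b in B].

Definition ideal_pow A (k : nat) : set R := iter k (ideal_mul A) setT.

Definition colon A f : set R := [set g | A (g * f)].

Definition is_prime P : Prop :=
  idealr_closed (mem P) /\ prime_idealr_closed (mem P).

(* Ass(A), i.e. the associated primes of the module R / A: the prime ideals
   that are the annihilator of the class of some f. *)
Definition Ass A : set (set R) :=
  [set P | is_prime P /\ exists f, P = colon A f].

End Ideals.

Section SymbolicPowers.
Variable R : idomainType.
Implicit Types (A P : set R).

(* The extension of an ideal A to the localization at P, realized inside the
   fraction field of R. *)
Definition loc_ext P A : set {fraction R} :=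
  [set x | exists a s, [/\ A a, ~ P s & x = tofrac a / tofrac s]].

Definition sym_pow A (k : nat) : set R :=
  \bigcap_(P in Ass A) (@tofrac R @^-1` loc_ext P (ideal_pow A k)).

(* The variable t is the variable of {poly R}. *)
Definition sym_rees A : set {poly R} := [set F | forall k, sym_pow A k F`_k].

End SymbolicPowers.

Definition subalg_gen (R : comNzRingType) (A : lalgType R) (G : set A) : set A :=
  smallest (fun B : set A => GRing.subalg_closed (mem B)) G.

(* Both orders are strict; the variables are x_1 > ... > x_n, where x_1 has
   index 0. *)
Definition lex_gt (n : nat) (u v : 'X_{1..n}) : bool :=
  [exists i : 'I_n,
     (v i < u i)%N && [forall j : 'I_n, (j < i)%N ==> (u j == v j)]].

Definition degrevlex_gt (n : nat) (u v : 'X_{1..n}) : bool :=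
  (mdeg v < mdeg u)%N ||
  ((mdeg u == mdeg v) &&
   [exists i : 'I_n,
      (u i < v i)%N && [forall j : 'I_n, (i < j)%N ==> (u j == v j)]]).

Section Rees.
Variables (K : fieldType) (n : nat).
Local Notation S := {mpoly K[n]}.

Definition veronese (d : nat) : set S :=
  ideal_gen [set 'X_[u] | u in [set u : 'X_{1..n} |
                                 (forall i, (u i <= 1)%N) /\ mdeg u = d]].

(* The pair (u, q) stands for the monomial u t^q of S[t]. *)
Definition tmon (a : 'X_{1..n} * nat) : {poly S} := 'X_[a.1] *: 'X^(a.2).

Definition tmon_gt (a b : 'X_{1..n} * nat) : bool :=
  (b.2 < a.2)%N || ((a.2 == b.2) && lex_gt a.1 b.1).

(* W is a minimal set of monomials generating B as an S-algebra. *)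
Definition min_mon_alg_gens (B : set {poly S}) (W : set ('X_{1..n} * nat)) :=
  minimal_such (fun W => subalg_gen (tmon @` W) = B) W.

Variable m : nat.
Local Notation T := {mpoly {mpoly K[n]}[m]}.

Definition phi (w : 'I_m -> 'X_{1..n} * nat) (p : T) : {poly S} :=
  mmap polyC (fun i => tmon (w i)) p.

Definition rees_ker (w : 'I_m -> 'X_{1..n} * nat) : set T :=
  [set p | phi w p = 0].

(* The pair (g, f) stands for the monomial g f of T, with g a monomial in the
   y's and f a monomial in the x's. *)
Definition Tmon (gf : 'X_{1..m} * 'X_{1..n}) : T := 'X_[gf.2] *: 'X_[gf.1].

Definition Tcoeff (p : T) (gf : 'X_{1..m} * 'X_{1..n}) : K :=
  (p@_(gf.1))@_(gf.2).

Definition Tmon_gt (a b : 'X_{1..m} * 'X_{1..n}) : bool :=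
  degrevlex_gt a.1 b.1 || ((a.1 == b.1) && lex_gt a.2 b.2).

Definition is_initial (p : T) (a : 'X_{1..m} * 'X_{1..n}) : Prop :=
  Tcoeff p a != 0 /\ forall b, Tcoeff p b != 0 -> b != a -> Tmon_gt a b.

Definition initial_ideal (L : set T) : set T :=
  ideal_gen [set Tmon a | a in [set a | exists2 p, L p & is_initial p a]].

(* a belongs to the minimal set of monomial generators of L. *)
Definition min_mon_gen (L : set T) (a : 'X_{1..m} * 'X_{1..n}) : Prop :=
  exists2 G, minimal_such (fun G => ideal_gen (Tmon @` G) = L) G & G a.

(* The factorization v v' with v in S and v' in K[y] of the monomial of a pair
   a is unique: v is the monomial a.2 in the x's. *)
Definition x_condition (w : 'I_m -> 'X_{1..n} * nat) : Prop :=
  forall a, min_mon_gen (initial_ideal (rees_ker w)) a -> (mdeg a.2 <= 1)%N.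

End Rees.

Arguments veronese K n d : clear implicits.
Arguments x_condition K {n m} w.

(* Main.v *)
Require Import Defs.
From mathcomp Require Import boolp classical_sets.
From mathcomp Require Import all_boot all_order all_algebra.
From mathcomp Require Import zify ring mpoly.

Set Implicit Arguments.
Unset Strict Implicit.
Unset Printing Implicit Defensive.

(** Write e = d - 1. The associated primes of I are the ideals generated by the
    variables outside an e-element set Y, so that I^(k) is spanned by the
    monomials that have, for each Y, degree at least k in the variables outside
    Y ([sym_pow_veronese]). Dividing such a monomial by the product of the
    variables that occur in it shows that the symbolic Rees algebra is generated
    over S by the x_F t^(|F| - e) with |F| > e, where F runs over singletons if
    e = 0. None of these factors further inside the algebra, hence they are the
    w_i ([min_mon_alg_gens_veronese]).

    The kernel J is spanned by binomials. A monomial g f, with g in the y's and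
    f in the x's, lies in in(J) exactly when some g' < g has the same t-degree
    as g and an x-degree that divides f times the x-degree of g. It is therefore
    enough to show that, if such a g' exists and f is not 1, then a single
    variable x_i dividing f already allows some h < g ([degrevlex_improve]): a
    minimal generator with f of degree at least 2 would otherwise be a proper
    multiple of g x_i, which is in in(J) too ([x_condition_of_improve]).

    Now g and g' are lists of sets F, the x-degree counts in how many sets each
    element occurs, and the t-degree fixes the sum of the sizes, up to e times
    the length of the list. There are two ways for g' to be smaller than g.
    - The lists have the same length and, once their common smallest sets are
      removed, the least set B left in g' is below the least set A left in g.
      If B has fewer elements than A, then some later set of g can receive an
      element, and A gives one up. If they have equally many elements, A swaps
      its first element outside B for a later element i of B. Where f does not
      supply i, it is taken from a later set of g and replaced there by an
      element that f does supply; [exchange] makes this possible without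
      violating the bounds on the sizes. This is [improve_head].
    - The list g' is shorter. Let U be the set of elements that lie in all sets
      of g. If U has at most e elements, then one set of g can be dissolved:
      e of its elements, those of U among them, are dropped, and the others move
      to sets of g that miss them. Otherwise counting gives a variable of f
      missing from two sets of g, which either fills the one gap left when
      |U| = e + 1, or enters a set of g while the smallest one, which then has
      more than e + 1 elements, loses one. This is [improve_length]. *)

(** * Lists of sets and exchanges of elements *)

Section SetFamilies.
Variable T : finType.
Implicit Types (F : {set T}) (s : seq {set T}).

Lemma subset_between (A B : {set T}) k : A \subset B -> #|A| <= k <= #|B| ->
  exists D : {set T}, [/\ A \subset D, D \subset B & #|D| = k].
Proof.
move=> sAB /andP[leA leB].
have [D sD] : exists D : {set T}, D \subset B :\: A /\ #|D| = k - #|A|.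
  have : 0 < #|[set D : {set T} | (D \subset B :\: A) && (#|D| == k - #|A|)]|.
    by rewrite cards_draws bin_gt0 cardsDS // leq_sub2r.
  rewrite card_gt0 => /set0Pn[D]; rewrite inE => /andP[? /eqP ?].
  by exists D.
case: sD => sD cD; exists (A :|: D); split.
- exact: subsetUl.
- by rewrite subUset sAB (subset_trans sD) ?subsetDl.
- rewrite cardsU; have -> : A :&: D = set0.
    apply/setP => x; rewrite !inE; apply/negbTE/negP => /andP[xA /(subsetP sD)].
    by rewrite inE xA.
  by rewrite cards0 subn0 cD subnKC.
Qed.

Definition cover_count s (x : T) := count (fun F => x \in F) s.

Definition total_card s := \sum_(F <- s) #|F|.

Lemma total_cardE s : total_card s = \sum_x cover_count s x.
Proof.
rewrite /total_card /cover_count.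
under [RHS]eq_bigr do rewrite -sum1_count big_mkcond.
rewrite exchange_big /=; apply: eq_bigr => F _.
by rewrite -big_mkcond /= sum1_card.
Qed.

Lemma sum_mem (E : {set T}) : \sum_x (x \in E) = #|E|.
Proof. by rewrite -big_mkcond /= sum1_card. Qed.

Lemma cover_count_rem s F x : F \in s ->
  cover_count s x = (x \in F) + cover_count (rem F s) x.
Proof. by move=> Fs; rewrite /cover_count (permP (perm_to_rem Fs)). Qed.

Lemma total_card_rem s F : F \in s -> total_card s = #|F| + total_card (rem F s).
Proof.
by move=> Fs; rewrite /total_card (perm_big _ (perm_to_rem Fs)) big_cons.
Qed.

Lemma cover_count_le s x : cover_count s x <= size s.
Proof. exact: count_size. Qed.

Lemma covered_ex s x : 0 < cover_count s x -> exists2 F, F \in s & x \in F.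
Proof. by rewrite -has_count => /hasP. Qed.

Lemma uncovered_ex s x : cover_count s x < size s ->
  exists2 F, F \in s & x \notin F.
Proof.
move=> lt; have : ~~ all (fun F => x \in F) s.
  by rewrite all_count neq_ltn lt.
by move=> /allPn.
Qed.

Lemma total_card_lt s s' : total_card s < total_card s' ->
  exists x, cover_count s x < cover_count s' x.
Proof.
rewrite !total_cardE => lt; apply/existsP; apply: contraLR lt.
rewrite negb_exists => /forallP le; rewrite -leqNgt.
by apply: leq_sum => x _; rewrite leqNgt.
Qed.

Section Exchange.
Variables (lo hi : nat).

Definition sized F := lo <= #|F| <= hi.

(** If no single set can swap i for j, take F containing both and F' containing
    neither. If F is not larger than F', an element z of F' outside F travels the
    other way, so that both sizes are kept; if F is larger, losing i and gaining
    j keeps both sizes between the bounds. *)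
Lemma exchange s i j :
  all sized s -> 0 < cover_count s i -> cover_count s j < size s ->
  exists s', [/\ all sized s', size s' = size s &
    forall x, cover_count s' x + (x == i) = cover_count s x + (x == j)].
Proof.
move=> szs /covered_ex [F Fs iF] /uncovered_ex [F' Fs' jF'].
have [->|neq_ij] := eqVneq i j; first by exists s.
have swap E : E \in s -> i \in E -> j \notin E -> exists s',
  [/\ all sized s', size s' = size s &
    forall x, cover_count s' x + (x == i) = cover_count s x + (x == j)].
  move=> Es iE jE; exists ((j |: E :\ i) :: rem E s); split.
  - move: szs; rewrite (perm_all _ (perm_to_rem Es)) /= => /andP[szE ->].
    rewrite /sized cardsU1 !inE (negPf jE) andbF /= andbT.
    by move: szE; rewrite /sized (cardsD1 i E) iE.
  - by rewrite (perm_size (perm_to_rem Es)).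
  - move=> x; rewrite (cover_count_rem x Es) /cover_count /= !inE.
    have [->|] := eqVneq x j.
      by rewrite (negPf jE) eq_sym (negPf neq_ij); clear; lia.
    by have [->|_ _] := eqVneq x i; rewrite ?iE; clear; lia.
have [jF|/swap] := boolP (j \in F); last exact.
have [iF'|iF'] := boolP (i \in F'); first exact: (swap F').
have Frs' : F' \in rem F s.
  apply: contraR jF' => nin; suff -> : F' = F by [].
  by move: Fs'; rewrite (perm_mem (perm_to_rem Fs)) inE (negPf nin) orbF => /eqP.
set r := rem F' (rem F s).
have ps : perm_eq s [:: F, F' & r].
  by rewrite (perm_trans (perm_to_rem Fs)) // perm_cons perm_to_rem.
have cs x : cover_count s x = (x \in F) + ((x \in F') + cover_count r x).
  by rewrite /cover_count (permP ps).
move: szs; rewrite (perm_all _ ps) /= => /and3P[szF szF' szr].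
have [leFF'|ltF'F] := leqP #|F| #|F'|.
  have : ~~ (F' \subset F).
    apply: contraL iF => sub; suff <- : F' = F by [].
    by apply/eqP; rewrite eqEcard sub.
  move=> /subsetPn[z zF' zF].
  have neq_zi : z != i by apply: contraNneq zF => ->.
  have neq_zj : z != j by apply: contraNneq jF' => <-.
  exists [:: z |: F :\ i, j |: F' :\ z & r]; split.
  - rewrite /= szr andbT /sized !cardsU1 !inE (negPf zF) (negPf jF') !andbF /=.
    by move: szF szF'; rewrite /sized (cardsD1 i F) iF (cardsD1 z F') zF' => -> ->.
  - by rewrite (perm_size ps).
  - move=> x; rewrite cs /cover_count /= !inE.
    have [->|] := eqVneq x z.
      by rewrite zF' (negPf zF) (negPf neq_zi) (negPf neq_zj) /=; clear; lia.
    have [->|] := eqVneq x i.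
      by rewrite iF (negPf iF') (negPf neq_ij) /=; clear; lia.
    by have [->|] := eqVneq x j; rewrite ?jF ?(negPf jF') /=; clear; lia.
exists [:: F :\ i, j |: F' & r]; split.
- rewrite /= szr andbT /sized cardsU1 jF'.
  by move: szF szF' ltF'F; rewrite /sized (cardsD1 i F) iF; clear; lia.
- by rewrite (perm_size ps).
- move=> x; rewrite cs /cover_count /= !inE.
  have [->|] := eqVneq x i.
    by rewrite iF (negPf iF') (negPf neq_ij) /=; clear; lia.
  by have [->|] := eqVneq x j; rewrite ?jF ?(negPf jF') /=; clear; lia.
Qed.

End Exchange.

(** Distinct elements do not compete for places, so that they can be inserted one
    after the other. *)
Lemma spread lo s (E : {set T}) :
  all (fun F => lo <= #|F|) s -> {in E, forall x, cover_count s x < size s} ->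
  exists s', [/\ all (fun F => lo <= #|F|) s', size s' = size s &
    forall x, cover_count s' x = cover_count s x + (x \in E)].
Proof.
elim: {E}_.+1 {-2}E s (ltnSn #|E|) => // k IHk E s leEk szs uncov.
have [->|[i iE]] := set_0Vmem E.
  by exists s; split=> // x; rewrite inE addn0.
have /uncovered_ex[F Fs iF] := uncov i iE.
have cs' x : cover_count ((i |: F) :: rem F s) x = cover_count s x + (x == i).
  rewrite (cover_count_rem x Fs) /cover_count /= !inE.
  by have [->|] := eqVneq x i; rewrite ?(negPf iF) /=; clear; lia.
have ss' : size ((i |: F) :: rem F s) = size s.
  by rewrite (perm_size (perm_to_rem Fs)).
case: (IHk (E :\ i) ((i |: F) :: rem F s)).
- by move: leEk; rewrite (cardsD1 i) iE.
- move: szs; rewrite (perm_all _ (perm_to_rem Fs)) /= => /andP[leF ->].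
  by rewrite andbT (leq_trans leF) // subset_leq_card // subsetUr.
- move=> x; rewrite !inE => /andP[/negPf neq_xi xE].
  by rewrite cs' neq_xi ss' addn0 uncov.
move=> s' [szs' eqs' cs]; exists s'; split=> [//||x]; first by rewrite eqs' ss'.
by rewrite cs cs' !inE; have [->|] := eqVneq x i; rewrite ?iE /=; clear; lia.
Qed.

End SetFamilies.

Section Improvement.
Variables (T : finType) (rk : T -> nat) (lo hi : nat).
Hypothesis rk_inj : injective rk.
Hypothesis hi_extremal : hi = lo \/ hi = #|T|.
Implicit Types (A B F : {set T}) (s Fs Gs : seq {set T}).

(** The order of the generators x_F t^(|F| - e), read on the sets F: first by
    size, then lexicographically, with the elements of least rank standing for
    the largest variables. *)
Definition below B A :=
  (#|B| < #|A|) || ((#|B| == #|A|) &&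
    [exists e, [&& e \in A, e \notin B &
      [forall x : T, (rk x < rk e) ==> ((x \in A) == (x \in B))]]]).

Lemma below_swap A e i : e \in A -> i \notin A -> rk e < rk i ->
  below (i |: A :\ e) A /\ #|i |: A :\ e| = #|A|.
Proof.
move=> eA iA lt_ei.
have eqc : #|i |: A :\ e| = #|A|.
  by rewrite cardsU1 !inE (negPf iA) andbF /= (cardsD1 e A) eA.
split=> //; rewrite /below eqc ltnn eqxx /=.
apply/existsP; exists e; rewrite eA !inE eqxx /= orbF.
have neq_ei : e != i by rewrite -(inj_eq rk_inj) neq_ltn lt_ei.
rewrite neq_ei /=; apply/forallP => x; apply/implyP => lt_xe; rewrite !inE.
have -> : (x == i) = false.
  by apply/negbTE; rewrite -(inj_eq rk_inj) neq_ltn (ltn_trans lt_xe).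
have -> : (x == e) = false; last by [].
by apply/negbTE; rewrite -(inj_eq rk_inj) neq_ltn lt_xe.
Qed.

(** The lists A :: Fs and B :: Gs are what remains of g and g' after the removal
    of their common smallest sets, and b is the exponent of f. *)
Lemma improve_head A B Fs Gs (b : T -> nat) i0 :
  0 < b i0 ->
  all (sized lo hi) (A :: Fs) -> all (sized lo hi) (B :: Gs) ->
  size Gs = size Fs -> below B A ->
  total_card (B :: Gs) = total_card (A :: Fs) ->
  (forall x, cover_count (B :: Gs) x <= cover_count (A :: Fs) x + b x) ->
  exists B' Fs' i, [/\ 0 < b i, all (sized lo hi) (B' :: Fs'),
    size Fs' = size Fs, below B' A &
    total_card (B' :: Fs') = total_card (A :: Fs) /\
    forall x, cover_count (B' :: Fs') x <= cover_count (A :: Fs) x + (x == i)].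
Proof.
move=> bi0; rewrite [all _ (A :: _)]/= [all _ (B :: _)]/= => /andP[szA szFs].
move=> /andP[szB szGs] eq_size ltBA eq_tot le_cnt.
have cntE C s x : cover_count (C :: s) x = (x \in C) + cover_count s x by [].
have totE C s : total_card (C :: s) = #|C| + total_card s.
  by rewrite /total_card big_cons.
have move_up i p : #|B| < #|A| -> p \in A -> cover_count Fs i < size Fs ->
    exists Fs', [/\ all (sized lo hi) (A :\ p :: Fs'), size Fs' = size Fs,
      below (A :\ p) A, total_card (A :\ p :: Fs') = total_card (A :: Fs) &
      forall x, cover_count (A :\ p :: Fs') x + (x == p) =
                cover_count (A :: Fs) x + (x == i)].
  move=> lt_card pA lt_i.
  have hi_max : hi = #|T|.
    case: hi_extremal => // eq_hl; move: lt_card szA szB; rewrite /sized eq_hl.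
    by clear; lia.
  have [F Fs_F iF] := uncovered_ex lt_i.
  have pA1 := cardsD1 p A; rewrite pA in pA1.
  have cF : #|i |: F| = #|F|.+1 by rewrite cardsU1 iF.
  exists ((i |: F) :: rem F Fs); split.
  - move: szFs; rewrite (perm_all _ (perm_to_rem Fs_F)) /= => /andP[szF ->].
    rewrite andbT; apply/andP; split.
      by move: pA1 lt_card szA szB; rewrite /sized; clear; lia.
    have : #|i |: F| <= #|T| by rewrite max_card.
    by move: szF; rewrite /sized cF hi_max; clear; lia.
  - by rewrite (perm_size (perm_to_rem Fs_F)).
  - by rewrite /below pA1 add1n ltnSn.
  - by rewrite !totE (total_card_rem Fs_F) cF pA1 add1n !addSn addnS.
  - move=> x; rewrite !cntE (cover_count_rem x Fs_F) !inE.
    move: (cover_count _ _) => c.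
    have [->|] := eqVneq x p; rewrite ?pA;
     (have [->|] := eqVneq _ i; rewrite ?(negPf iF); clear; lia).
(* if f is not used at all, the given list already does *)
case: (boolP [forall x, cover_count (B :: Gs) x <= cover_count (A :: Fs) x]).
  move=> /forallP le; exists B, Gs, i0; split=> //=; first by rewrite szB.
  by split=> // x; rewrite (leq_trans (le x)) ?leq_addr.
rewrite negb_forall => /existsP[s]; rewrite -ltnNge => lt_s.
have bs : 0 < b s by have := le_cnt s; move: lt_s; clear; lia.
have [lt_card|le_card] := ltnP #|B| #|A|.
  (* the sets after B are larger in total than those after A: one of the latter
     has room for some i *)
  have [|i lt_i] := @total_card_lt _ Fs Gs.
    by move: eq_tot; rewrite !totE; move: lt_card; clear; lia.
  have lt_iF : cover_count Fs i < size Fs.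
    by rewrite (leq_trans lt_i) // -eq_size cover_count_le.
  have [iA|iA] := boolP (i \in A).
    have [Fs' [sz' eqs' lt' tot' cnt']] := move_up i i lt_card iA lt_iF.
    exists (A :\ i), Fs', i0; split=> //; split=> // x.
    by have := cnt' x; clear; lia.
  have bi : 0 < b i.
    by have := le_cnt i; rewrite !cntE (negPf iA); move: lt_i; clear; lia.
  have /card_gt0P[p pA] : 0 < #|A| by exact: leq_ltn_trans lt_card.
  have [Fs' [sz' eqs' lt' tot' cnt']] := move_up i p lt_card pA lt_iF.
  exists (A :\ p), Fs', i; split=> //; split=> // x.
  by have := cnt' x; clear; lia.
move: ltBA; rewrite /below ltnNge le_card /= => /andP[/eqP eq_card].
move=> /existsP[e /and3P[eA eB /forallP agree]].
have [i iB iA] : exists2 i, i \in B & i \notin A.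
  apply/subsetPn; apply: contra eB => sub; suff -> : B = A by [].
  by apply/eqP; rewrite eqEcard sub eq_card leqnn.
have lt_e x : x \in B -> x \notin A -> rk e < rk x.
  move=> xB xA; rewrite ltnNge leq_eqVlt negb_or; apply/andP; split.
    by apply: contraNneq xA => /rk_inj ->.
  by apply: contraL (agree x) => ->; rewrite xB (negPf xA).
have swap_ok j : j \notin A -> rk e < rk j -> [/\ sized lo hi (j |: A :\ e),
   below (j |: A :\ e) A, #|j |: A :\ e| = #|A| & forall x,
   (x \in j |: A :\ e) + (x == e) = (x \in A) + (x == j)].
  move=> jA lt_ej; have [lt eqc] := below_swap eA jA lt_ej.
  split=> //; first by rewrite /sized eqc.
  move=> x; rewrite !inE; have [->|] := eqVneq x j; have [->|] := eqVneq _ e;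
    rewrite ?eA ?(negPf jA); clear; lia.
(* an element supplied by f that may replace e in A *)
have direct j : 0 < b j -> j \notin A -> rk e < rk j ->
  exists B' Fs' i, [/\ 0 < b i, all (sized lo hi) (B' :: Fs'),
    size Fs' = size Fs, below B' A &
    total_card (B' :: Fs') = total_card (A :: Fs) /\
    forall x, cover_count (B' :: Fs') x <= cover_count (A :: Fs) x + (x == i)].
  move=> bj jA lt_ej; have [sz lt eqc hx] := swap_ok j jA lt_ej.
  exists (j |: A :\ e), Fs, j; split=> //; first by rewrite /= sz.
  split; first by rewrite !totE eqc.
  by move=> x; have := hx x; rewrite ?cntE; clear; lia.
have [/andP[sA lt_es]|sA] := boolP ((s \notin A) && (rk e < rk s)).
  exact: direct bs sA lt_es.
have lt_ei := lt_e i iB iA.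
have [bi|bi0'] := posnP (b i); last exact: direct iA lt_ei.
have covi : 0 < cover_count Fs i.
  by have := le_cnt i; rewrite !cntE iB (negPf iA) bi; clear; lia.
(* s is in excess in B :: Gs, so it is missing from some later set, unless it
   could have entered A directly *)
have uncs : cover_count Fs s < size Fs.
  have leG := cover_count_le Gs s.
  move: lt_s sA; rewrite !cntE -eq_size; case: (boolP (s \in A)) => sA /=.
    by move: leG; case: (s \in B); clear; lia.
  have [/lt_e/(_ sA) ->//|_ lt_s _] := boolP (s \in B).
  by move: lt_s leG; clear; lia.
have [Fs' [szFs' eqFs' cntFs']] := exchange szFs covi uncs.
have [sz lt eqc hx] := swap_ok i iA lt_ei.
exists (i |: A :\ e), Fs', s; split=> //; first by rewrite /= sz.
have totF : total_card Fs' = total_card Fs.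
  apply/eqP; rewrite -(eqn_add2r 1); apply/eqP.
  rewrite !total_cardE; have sum1 j : \sum_(x : T) (x == j) = 1.
    by rewrite (bigD1 j) //= eqxx big1 // => x /negPf ->.
  by rewrite -{1}(sum1 i) -(sum1 s) -!big_split; apply: eq_bigr => x _ /=.
split; first by rewrite !totE eqc totF.
by move=> x; rewrite ?cntE; have := hx x; have := cntFs' x; clear; lia.
Qed.

End Improvement.

Section Shortening.
Variables (T : finType) (e : nat).
Implicit Types (F : {set T}) (s Fs Gs : seq {set T}).

Notation large := (all (fun F => e < #|F|)).

(** The t-degree survives, because the |F| - e elements of E that enter other
    sets make up for the factor t^(|F| - e) lost with F. *)
Lemma dissolve F s (E : {set T}) :
  F \in s -> large s -> #|E| + e = #|F| -> {in E, forall x,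
  cover_count (rem F s) x < (size s).-1} ->
  exists s', [/\ large s', size s = (size s').+1,
    total_card s' + size s * e = total_card s + size s' * e &
    forall x, cover_count s' x + (x \in F) = cover_count s x + (x \in E)].
Proof.
move=> Fs lF cE unc.
case: (@spread _ e.+1 (rem F s) E).
- by move: lF; rewrite (perm_all _ (perm_to_rem Fs)) => /andP[].
- by move=> x xE; rewrite size_rem ?unc.
move=> s' [ls' eqs' cs'].
have sz : size s = (size s').+1.
  by rewrite eqs' size_rem // prednK // -has_predT; apply/hasP; exists F.
exists s'; split=> //.
  have := total_card_rem Fs; rewrite sz mulSn => ->; rewrite -cE.
  have -> : total_card s' = total_card (rem F s) + #|E|.
    by rewrite !total_cardE -sum_mem -big_split; apply: eq_bigr => x _ /=.
  by clear; lia.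
by move=> x; rewrite cs' (cover_count_rem x Fs); clear; lia.
Qed.

(** The obstacle to dissolving a set is the set U of elements common to all sets:
    no other set can take them, and at most e of them can be dropped. *)
Lemma improve_length Fs Gs (b : T -> nat) i0 :
  0 < b i0 -> large Fs -> size Gs < size Fs ->
  total_card Gs + size Fs * e = total_card Fs + size Gs * e ->
  (forall x, cover_count Gs x <= cover_count Fs x + b x) ->
  exists Hs i, [/\ 0 < b i, large Hs,
    size Hs < size Fs \/ size Hs = size Fs /\
      exists2 H, H \in Hs & {in Fs, forall F, #|H| < #|F|},
    total_card Hs + size Fs * e = total_card Fs + size Hs * e &
    forall x, cover_count Hs x <= cover_count Fs x + (x == i)].
Proof.
move=> bi0 lF lt_size eq_tot le_cnt.
pose U := [set x | cover_count Fs x == size Fs].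
have UF F : F \in Fs -> U \subset F.
  move=> FFs; apply/subsetP => x; rewrite inE /cover_count -all_count.
  by move=> /allP/(_ F FFs).
have cnt_rem F x : F \in Fs -> x \notin U ->
    cover_count (rem F Fs) x + (x \in F) < size Fs.
  move=> FFs xU; rewrite addnC -cover_count_rem // ltn_neqAle cover_count_le.
  by move: xU; rewrite inE => ->.
have [leU|ltU] := leqP #|U| e.
  have [F FFs] : exists F, F \in Fs.
    by case: (Fs) lt_size => // F s _; exists F; rewrite mem_head.
  have [D [sUD sDF cD]] : exists D : {set T}, [/\ U \subset D, D \subset F & #|D| = e].
    apply: subset_between; first exact: UF.
    by rewrite leU /= ltnW // (allP lF).
  case: (@dissolve F Fs (F :\: D) FFs lF).
  - by rewrite cardsDS // cD subnK // ltnW // (allP lF).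
  - move=> x; rewrite inE => /andP[xD xF].
    have := cnt_rem F x FFs (contra (subsetP sUD x) xD).
    by rewrite xF addn1; case: (size Fs).
  move=> Hs [lH sH tH cH]; exists Hs, i0; split=> //; first by left; rewrite sH.
  move=> x; have := cH x; rewrite inE.
  by case: (x \in F); rewrite ?andbF ?andbT; case: (x \notin D); clear; lia.
(* If no variable of f is missing from two sets, then each x occurs at most
   min (cover_count Fs x) (size Gs) times in Gs; as U has more than e elements,
   Gs is then too small for the t-degree. *)
have [i bi unci] : exists2 i, 0 < b i & (cover_count Fs i).+1 < size Fs.
  apply/exists_inP; apply: contraTT isT; rewrite negb_exists_in => /forall_inP noi.
  suff : total_card Gs + #|U| * (size Fs - size Gs) <= total_card Fs.
    have : e.+1 * (size Fs - size Gs) <= #|U| * (size Fs - size Gs).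
      by rewrite leq_mul2r ltU orbT.
    rewrite mulSn mulnBr -[size Fs * e]mulnC -[size Gs * e]mulnC in eq_tot *.
    have : e * size Gs <= e * size Fs by rewrite leq_mul2l ltnW ?orbT.
    by move: lt_size eq_tot; clear; lia.
  rewrite !total_cardE -sum_mem big_distrl -big_split leq_sum //= => x _.
  have leG := cover_count_le Gs x.
  have [|xU] := boolP (x \in U).
    by rewrite inE => /eqP ->; move: leG lt_size; clear; lia.
  rewrite mul0n addn0; have := le_cnt x; have [-> | bx _] := posnP (b x).
    by rewrite addn0.
  by have := noi x bx; move: leG lt_size; clear; lia.
have iU : i \notin U.
  by rewrite inE neq_ltn (ltn_trans _ unci).
have [leU|ltU'] := leqP #|U| e.+1.
  have eqU : #|U| = e.+1 by apply/eqP; rewrite eqn_leq leU.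
  have [F FFs iF] := uncovered_ex (ltnW unci).
  case: (@dissolve F Fs (i |: F :\: U) FFs lF).
  - rewrite cardsU1 !inE (negPf iF) andbF /= cardsDS ?UF // eqU.
    by have := allP lF F FFs; clear; lia.
  - move=> x; rewrite !inE => /orP[/eqP ->|/andP[xU xF]].
      have := cover_count_rem i FFs; rewrite (negPf iF) add0n => <-.
      by move: unci; case: (size Fs).
    have := cnt_rem F x FFs; rewrite !inE xU xF addn1 => /(_ isT).
    by case: (size Fs).
  move=> Hs [lH sH tH cH]; exists Hs, i; split=> //; first by left; rewrite sH.
  move=> x; have := cH x; rewrite !inE.
  by case: (x \in F); case: (x == i); case: (_ == size Fs); rewrite /=;
     clear; lia.
have [F0 FFs0] : exists F, F \in Fs.
  by case: (Fs) lt_size => // F s _; exists F; rewrite mem_head.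
have [F FFs minF] : exists2 F, F \in Fs & {in Fs, forall F', #|F| <= #|F'|}.
  case: (@arg_minnP _ F0 (mem Fs) (fun F => #|F|) FFs0) => F FFs minF.
  by exists F.
have [F' FrF' iF'] : exists2 F', F' \in rem F Fs & i \notin F'.
  apply: uncovered_ex; rewrite size_rem //.
  by have := cover_count_rem i FFs; move: unci; case: (size Fs) => //=; clear; lia.
have ltF : e.+1 < #|F| by rewrite (leq_trans ltU') // subset_leq_card ?UF.
have /card_gt0P[p pF] : 0 < #|F| by rewrite (leq_trans _ ltF).
have cFp : #|F| = #|F :\ p|.+1 by rewrite (cardsD1 p) pF.
have sizeF : size (rem F Fs) = (size (rem F' (rem F Fs))).+1.
  rewrite (size_rem FrF') prednK // -has_predT; apply/hasP; exists F' => //.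
have sizeH : (size (rem F' (rem F Fs))).+2 = size Fs.
  rewrite -sizeF (size_rem FFs) prednK // -has_predT; apply/hasP; exists F => //.
exists [:: F :\ p, i |: F' & rem F' (rem F Fs)], i; split=> //.
- have := lF; rewrite (perm_all _ (perm_to_rem FFs)) /= => /andP[_].
  rewrite (perm_all _ (perm_to_rem FrF')) /= => /andP[lF' ->].
  by rewrite andbT -ltnS -cFp ltF /= cardsU1 iF' ltnS ltnW.
- right; split=> //; exists (F :\ p); rewrite ?mem_head // => F1 F1s.
  by rewrite -cFp minF.
- rewrite (total_card_rem FFs) (total_card_rem FrF') /= sizeH /total_card.
  by rewrite !big_cons cFp cardsU1 iF' /=; clear; lia.
- move=> x; rewrite (cover_count_rem x FFs) (cover_count_rem x FrF').
  rewrite /cover_count /= !inE.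
  by case: (x == i); case: (x == p); case: (x \in F); case: (x \in F');
     rewrite /=; clear; lia.
Qed.

End Shortening.

(** * The degree reverse lexicographic order *)

Section DegRevLex.
Variable m : nat.
Implicit Types (g P X Y R : 'X_{1..m}).

(** P stands for the smallest factors that two monomials share: among monomials
    of equal degree, the one whose smallest remaining factor is smaller is the
    smaller one. Indices are opposite to the order of the variables. *)
Lemma degrevlex_gt_addl P X Y (i : 'I_m) :
  mdeg X = mdeg Y -> 0 < Y i -> (forall l : 'I_m, 0 < X l -> l < i) ->
  degrevlex_gt (P + X)%MM (P + Y)%MM.
Proof.
move=> eq_deg Yi supX; rewrite /degrevlex_gt !mdegD eq_deg ltnn eqxx /=.
case: (@arg_maxnP _ i (fun l => 0 < Y l) (fun l => val l) Yi) => k Yk maxk.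
have X0 (l : 'I_m) : k <= l -> X l = 0.
  move=> le_kl; apply/eqP; rewrite -leqn0 leqNgt; apply/negP => /supX.
  by rewrite ltnNge (leq_trans (maxk i Yi) le_kl).
apply/existsP; exists k; rewrite !mnmDE X0 // addn0 -addn1 leq_add2l Yk /=.
apply/forallP => l; apply/implyP => lt_kl; rewrite !mnmDE X0 1?ltnW //.
suff -> : Y l = 0 by [].
by apply/eqP; rewrite -leqn0 leqNgt; apply/negP => /maxk /=; rewrite leqNgt lt_kl.
Qed.

Lemma mnm_sub1 X (i : 'I_m) : 0 < X i -> exists R, X = (U_(i) + R)%MM.
Proof.
move=> Xi; exists (X - U_(i))%MM; rewrite addmC submK //.
by apply/mnm_lepP => l; rewrite mnm1E; case: eqP => // <-.
Qed.

Lemma mdeg_gt0_ex X : 0 < mdeg X -> exists i : 'I_m, 0 < X i.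
Proof.
move=> degX; apply/existsP; apply: contraLR degX.
rewrite negb_exists => /forallP X0; rewrite mdegE big1 // => i _.
by apply/eqP; rewrite -leqn0 leqNgt X0.
Qed.

(** Let i be the largest index at which g and g' differ. P collects the factors of
    g of index at least i, and j is the largest index of a remaining factor. *)
Lemma degrevlex_gt_split g g' : degrevlex_gt g g' -> mdeg g = mdeg g' ->
  exists P i j R R', [/\ g = (P + (U_(j) + R))%MM, g' = (P + (U_(i) + R'))%MM,
    j < i & forall l : 'I_m, 0 < R l -> l <= j].
Proof.
move=> gt_gg' eq_deg; move: gt_gg'; rewrite /degrevlex_gt eq_deg ltnn eqxx /=.
move=> /existsP[i /andP[lt_gg' /forallP eq_gg']].
pose P := [multinom if i <= l then g l else 0 | l < m].
have lePg : (P <= g)%MM by apply/mnm_lepP => l; rewrite mnmE; case: ifP.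
have lePg' : (P <= g')%MM.
  apply/mnm_lepP => l; rewrite mnmE; case: ifP => //.
  rewrite leq_eqVlt => /orP[/eqP/val_inj <-|lt_il]; first exact: ltnW.
  by have := eq_gg' l; rewrite lt_il => /eqP ->.
have [R' eqR'] : exists R', (g' - P)%MM = (U_(i) + R')%MM.
  by apply: mnm_sub1; rewrite mnmBE mnmE leqnn subn_gt0.
have : 0 < mdeg (g - P)%MM.
  have := congr1 mdeg (submK lePg); have := congr1 mdeg (submK lePg').
  by rewrite eqR' !mdegD mdeg1 eq_deg; clear; lia.
move=> /mdeg_gt0_ex[j0 Qj0].
case: (@arg_maxnP _ j0 (fun l => 0 < (g - P)%MM l) (fun l => val l) Qj0).
move=> j Qj maxj; have [R eqR] := mnm_sub1 Qj.
exists P, i, j, R, R'; rewrite -eqR -eqR' ![(P + _)%MM]addmC !submK //.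
split=> // [|l Rl].
  rewrite ltnNge; apply: contraTN Qj => le_ij.
  by rewrite mnmBE mnmE le_ij subnn.
by apply: maxj; rewrite eqR mnmDE ltn_addl.
Qed.

End DegRevLex.

(** * Supports of elements of ideals and subalgebras *)

Import GRing.Theory.
Local Open Scope ring_scope.

Section Ideals.
Variable R : comNzRingType.
Implicit Types (A B : set R) (x r : R).

Lemma ideal_gen_is_ideal (A : set R) : is_ideal (ideal_gen A).
Proof.
split=> [B [[]]//|a f g Af Ag B [[B0 Blin] AB]].
apply: (Blin); first exact: (Af B (conj (conj B0 Blin) AB)).
exact: (Ag B (conj (conj B0 Blin) AB)).
Qed.

Lemma ideal_gen_mem (A : set R) x : A x -> ideal_gen A x.
Proof. by move=> Ax B [_]; apply. Qed.

Lemma ideal_gen_sub (A B : set R) x :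
  is_ideal B -> (forall y, A y -> B y) -> ideal_gen A x -> B x.
Proof. by move=> idB AB; apply; split. Qed.

Lemma ideal_gen_mull (A : set R) r x :
  ideal_gen A x -> ideal_gen A (r * x).
Proof.
move=> Ax B [[B0 Blin] AB]; rewrite -[_ * _]addr0.
exact: (Blin r x 0 (Ax B (conj (conj B0 Blin) AB)) B0).
Qed.

Lemma colon_is_ideal (A : set R) x :
  is_ideal A -> is_ideal (colon A x).
Proof.
move=> [A0 Alin]; split; first by rewrite /colon /= mul0r.
by move=> a u v Au Av; rewrite /colon /= mulrDl -mulrA; apply: Alin.
Qed.

End Ideals.

Lemma addr_neq0 (V : zmodType) (x y : V) : x + y != 0 -> x != 0 \/ y != 0.
Proof. by have [->|] := eqVneq x 0; [rewrite add0r; right|left]. Qed.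

(** The trailing degree of a product of polynomials over a domain is the sum of
    the trailing degrees. *)
Lemma low_coef_cancel (R : idomainType) (p q : {poly R}) k :
  q`_0 != 0 -> (forall j, (j < k)%N -> (p * q)`_j = 0) ->
  forall j, (j < k)%N -> p`_j = 0.
Proof.
move=> q0 low; elim/ltn_ind=> j IHj lt_jk; have := low j lt_jk.
rewrite coefM big_ord_recr /= subnn big1 ?add0r => [/eqP|i _].
  by rewrite mulf_eq0 (negPf q0) orbF => /eqP.
by rewrite IHj ?mul0r // (ltn_trans _ lt_jk).
Qed.

Section Supports.
Variables (R : comNzRingType) (n : nat).

Lemma msupp_mul_split (p q : {mpoly R[n]}) u : (p * q)@_u != 0 ->
  exists v v', [/\ p@_v != 0, q@_v' != 0 & u = (v + v')%MM].
Proof.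
rewrite -mcoeff_msupp => /msuppM_le /allpairsP[[v v'] /= [pv qv' ->]].
by exists v, v'; rewrite -!mcoeff_msupp.
Qed.

End Supports.

Section MonomialIdeals.
Variables (K : fieldType) (n m : nat).
Notation S := {mpoly K[n]}.
Notation T := {mpoly {mpoly K[n]}[m]}.
Implicit Types (a b c : 'X_{1..m} * 'X_{1..n}).

Lemma Tcoeff_mul_split (p q : T) a : Tcoeff (p * q) a != 0 ->
  exists b c, [/\ Tcoeff p b != 0, Tcoeff q c != 0,
    a.1 = (b.1 + c.1)%MM & a.2 = (b.2 + c.2)%MM].
Proof.
case: a => g f; rewrite /Tcoeff /= mcoeffM => nz.
have /existsP[k /andP[/eqP gk nzk]] : [exists k : 'X_{1..m < (mdeg g).+1, (mdeg g).+1},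
    (g == (k.1 + k.2)%MM) && ((p@_k.1 * q@_k.2)@_f != 0)].
  apply: contraR nz; rewrite negb_exists => /forallP all0.
  rewrite raddf_sum /= big1 // => k gk; have := all0 k.
  by rewrite gk /= negbK => /eqP.
have [v [v' [pv qv' ->]]] := msupp_mul_split nzk.
by exists (k.1 : 'X_{1..m}, v), (k.2 : 'X_{1..m}, v').
Qed.

Lemma TcoeffD (p q : T) a : Tcoeff (p + q) a = Tcoeff p a + Tcoeff q a.
Proof. by rewrite /Tcoeff !mcoeffD. Qed.

Lemma TcoeffB (p q : T) a : Tcoeff (p - q) a = Tcoeff p a - Tcoeff q a.
Proof. by rewrite /Tcoeff !mcoeffB. Qed.

Lemma Tcoeff_Tmon a b : Tcoeff (Tmon K a) b = (a == b)%:R.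
Proof.
case: a b => [g f] [g' f']; rewrite /Tcoeff /Tmon /= mcoeffZ mcoeffX xpair_eqE.
case: (g == g'); last by rewrite mulr0 mcoeff0.
by rewrite mulr1 mcoeffX.
Qed.

(** The polynomials all of whose terms are divisible by some member of G form an
    ideal. *)
Lemma ideal_gen_Tmon_divisor (G : set ('X_{1..m} * 'X_{1..n})) a :
  ideal_gen (@Tmon K n m @` G)%classic (Tmon K a) ->
  exists c, [/\ G c, (c.1 <= a.1)%MM & (c.2 <= a.2)%MM].
Proof.
pose I : set T := fun p => forall a, Tcoeff p a != 0 ->
  exists c, [/\ G c, (c.1 <= a.1)%MM & (c.2 <= a.2)%MM].
move=> /(_ I) Ia; apply: Ia; last by rewrite Tcoeff_Tmon eqxx oner_eq0.
split; [split=> [|p u v Iu Iv]|] => [b|b|_ [c Gc <-] b].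
- by rewrite /Tcoeff !mcoeff0 eqxx.
- rewrite TcoeffD => /addr_neq0[|/Iv//].
  move=> /Tcoeff_mul_split[b1 [b2 [_ /Iu[c [Gc le1 le2]] -> ->]]].
  by exists c; split=> //; rewrite (lepm_trans _ (lem_addl _ _)).
- rewrite Tcoeff_Tmon; case: (c =P b) => [<- _|_]; last by rewrite eqxx.
  by exists c; rewrite !lepm_refl.
Qed.

Lemma Tmon_mul a b : Tmon K ((a.1 + b.1)%MM, (a.2 + b.2)%MM) = Tmon K a * Tmon K b.
Proof. by rewrite /Tmon /= !mpolyXD -scalerAl -scalerAr scalerA. Qed.

Lemma Tmon_split a c : (c.1 <= a.1)%MM -> (c.2 <= a.2)%MM ->
  Tmon K a = Tmon K ((a.1 - c.1)%MM, (a.2 - c.2)%MM) * Tmon K c.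
Proof. by move=> le1 le2; rewrite -Tmon_mul /= !submK //; case: a {le1 le2}. Qed.

End MonomialIdeals.

Section MonomialSubalgebras.
Variables (K : fieldType) (n : nat).
Notation S := {mpoly K[n]}.
Implicit Types (M W : set ('X_{1..n} * nat)).

(** If M is a monoid of monomials of S[t] that contains those of S, then the
    polynomials with support in M form an S-subalgebra. *)
Lemma subalg_gen_support M W (H : {poly S}) :
  (forall u, M (u, 0%N)) ->
  (forall a b, M a -> M b -> M ((a.1 + b.1)%MM, (a.2 + b.2)%N)) ->
  (forall a, W a -> M a) ->
  subalg_gen (@tmon K n @` W)%classic H ->
  forall u k, (H`_k)@_u != 0 -> M (u, k).
Proof.
move=> M0 MD WM; pose B : set {poly S} := fun H =>
  forall u k, (H`_k)@_u != 0 -> M (u, k).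
move=> /(_ B); apply; split; last first.
  move=> _ [[v l] Wa <-] u k; rewrite /tmon /= coefZ coefXn.
  case: (k =P l) => [->|_]; last by rewrite mulr0 mcoeff0 eqxx.
  rewrite mulr1 mcoeffX; case: (v =P u) => [<- _|_]; last by rewrite eqxx.
  exact: WM.
split.
- rewrite in_setE => u k; rewrite coef1; case: (k =P 0%N) => [-> _|_]; first exact: M0.
  by rewrite mcoeff0 eqxx.
- move=> r F G; rewrite !in_setE => BF BG u k; rewrite coefD coefZ mcoeffD.
  move=> /addr_neq0[/msupp_mul_split[v [v' [_ nz ->]]]|/BG//].
  by have := MD _ _ (M0 v) (BF _ _ nz); rewrite add0n.
- move=> F G; rewrite !in_setE => BF BG u k; rewrite coefM => nz.
  have /existsP[i] : [exists i : 'I_k.+1, (F`_i * G`_(k - i))@_u != 0].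
    apply: contraR nz; rewrite negb_exists => /forallP all0.
    rewrite raddf_sum /= big1 // => i _; have := all0 i.
    by rewrite negbK => /eqP.
  move=> /msupp_mul_split[v [v' [nzF nzG ->]]].
  have := MD _ _ (BF _ _ nzF) (BG _ _ nzG).
  by rewrite /= subnKC // -ltnS.
Qed.

End MonomialSubalgebras.

(** * Symbolic powers of the squarefree Veronese ideal *)

Section SymbolicPowersOfVeronese.
Variables (K : fieldType) (n : nat).
Notation S := {mpoly K[n]}.
Implicit Types (u v : 'X_{1..n}) (Y F : {set 'I_n}) (f g : S).

Definition mnm_set F : 'X_{1..n} := [multinom (i \in F : nat) | i < n].

Definition wt_off Y u : nat := (\sum_(i | i \notin Y) u i)%N.

(** The k-th power of the prime ideal generated by the variables outside Y. *)
Definition order_ge Y k f := forall u, f@_u != 0 -> (k <= wt_off Y u)%N.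

Lemma wt_offD Y u v : wt_off Y (u + v)%MM = (wt_off Y u + wt_off Y v)%N.
Proof. by rewrite -big_split; apply: eq_bigr => i _; rewrite mnmDE. Qed.

Lemma wt_off0 Y : wt_off Y 0%MM = 0%N.
Proof. by rewrite /wt_off big1 // => i _; rewrite mnm0E. Qed.

Lemma wt_offU Y i : wt_off Y U_(i)%MM = (i \notin Y).
Proof.
rewrite /wt_off; have [iY|iY] := boolP (i \in Y).
  by rewrite big1 // => j jY; rewrite mnm1E; case: eqP jY => // <-; rewrite iY.
rewrite (bigD1 i) //= mnm1E eqxx big1 // => j /andP[_ /negPf neq_ji].
by rewrite mnm1E eq_sym neq_ji.
Qed.

Lemma wt_off_gt0 Y u : (0 < wt_off Y u)%N ->
  exists2 i, i \notin Y & (U_(i) <= u)%MM.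
Proof.
rewrite /wt_off lt0n sum_nat_eq0 negb_forall => /existsP[i].
rewrite negb_imply => /andP[iY ui]; exists i => //.
by apply/mnm_lepP => j; rewrite mnm1E; case: eqP => // <-; rewrite lt0n.
Qed.

(** A ring morphism which multiplies the variables outside Y by a new variable.
    Through it, the order of vanishing along the variables outside Y inherits
    its additivity from the trailing degree of univariate polynomials. *)
Definition grading Y : S -> {poly S} :=
  mmap (@polyC S \o @mpolyC n K) (fun i => ('X_i : S) *: 'X^(i \notin Y)).

Lemma gradingM Y : {morph grading Y : f g / f * g}.
Proof. by move=> f g; rewrite /grading rmorphM. Qed.

Lemma mcoeff_grading Y f j u :
  ((grading Y f)`_j)@_u = f@_u * (wt_off Y u == j)%:R.
Proof.
have mono v : mmap1 (fun i => ('X_i : S) *: 'X^(i \notin Y) : {poly S}) v =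
    'X_[v] *: 'X^(wt_off Y v).
  rewrite mpolyXE_id /mmap1 /wt_off -prodrXr [X in _ *: X]big_mkcond -scaler_prod /=.
  by apply: eq_bigr => i _; rewrite exprZn -exprM; case: (i \notin Y);
     rewrite ?mul1n ?mul0n.
rewrite /grading /mmap coef_sum raddf_sum /= [f in RHS]mpolyE raddf_sum /= mulr_suml.
apply: eq_bigr => v _; rewrite mono mul_polyC coefZ coefZ coefXn mcoeffCM mcoeffZ.
rewrite -mulrA; congr (_ * _).
have -> (p : S) (b : bool) : (p * b%:R)@_u = p@_u * b%:R.
  by case: b; rewrite ?mulr1 // !mulr0 mcoeff0.
by rewrite mcoeffX [j == _]eq_sym; case: (v =P u) => [->|_]; rewrite ?mul1r // !mul0r.
Qed.

Lemma order_geP Y k f :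
  order_ge Y k f <-> forall j, (j < k)%N -> (grading Y f)`_j = 0.
Proof.
split=> [of_ j lt_jk | low u fu].
  apply/mpolyP => u; rewrite mcoeff_grading mcoeff0.
  have [fu|] := eqVneq f@_u 0; first by rewrite fu mul0r.
  by move=> /of_ le; rewrite gtn_eqF ?mulr0 // (leq_trans lt_jk).
rewrite leqNgt; apply: contraNN fu => /low /(congr1 (mcoeff u)).
by rewrite mcoeff_grading eqxx mulr1 mcoeff0 => ->.
Qed.

Lemma order_ge_cancel Y k f g :
  ~ order_ge Y 1 g -> order_ge Y k (f * g) -> order_ge Y k f.
Proof.
move=> g0 /order_geP; rewrite gradingM => low; apply/order_geP.
apply: low_coef_cancel low; apply/eqP => g00; case: g0.
by apply/order_geP => -[].
Qed.

Lemma order_geM Y j k f g :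
  order_ge Y j f -> order_ge Y k g -> order_ge Y (j + k) (f * g).
Proof.
move=> of_ og u /msupp_mul_split[v [v' [/of_ le1 /og le2 ->]]].
by rewrite wt_offD leq_add.
Qed.

Lemma order_ge_ideal Y k : is_ideal (order_ge Y k).
Proof.
split=> [u|a f g of_ og u]; first by rewrite mcoeff0 eqxx.
rewrite mcoeffD => /addr_neq0[|/og//].
by rewrite -[k]add0n; apply: order_geM.
Qed.

Lemma order_geX Y k u : order_ge Y k 'X_[u] <-> (k <= wt_off Y u)%N.
Proof.
split=> [|le v]; first by apply; rewrite mcoeffX eqxx oner_eq0.
by rewrite mcoeffX; case: (u =P v) => [<-|_] //; rewrite eqxx.
Qed.

Lemma order_ge_prime Y : is_prime (order_ge Y 1).
Proof.
split; first split.
- by rewrite in_setE; have [] := order_ge_ideal Y 1.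
- rewrite -mpolyX0; apply/negP; rewrite in_setE => /order_geX.
  by rewrite wt_off0.
- move=> a f g; rewrite !in_setE; have [_] := order_ge_ideal Y 1; exact.
move=> f g; rewrite in_setE => ofg.
have [og|og] := pselect (order_ge Y 1 g).
  by apply/orP; right; rewrite in_setE.
by apply/orP; left; rewrite in_setE; apply: order_ge_cancel ofg.
Qed.

Lemma ideal_of_monomials (B : set S) f : is_ideal B ->
  (forall u, f@_u != 0 -> B 'X_[u]) -> B f.
Proof.
move=> [B0 Blin] Bmon; rewrite [f]mpolyE.
have : {subset msupp f <= msupp f} by [].
elim: {-2}(msupp f) => [_|u s IHs sub]; first by rewrite big_nil.
rewrite big_cons -mul_mpolyC; apply: Blin.
  by apply: Bmon; rewrite -mcoeff_msupp sub ?mem_head.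
by apply: IHs => v vs; rewrite sub ?inE ?vs ?orbT.
Qed.

Lemma mdeg_mnm_set F : mdeg (mnm_set F) = #|F|.
Proof.
rewrite mdegE -sum1_card [RHS]big_mkcond /=.
by apply: eq_bigr => i _; rewrite mnmE; case: (i \in F).
Qed.

Lemma mnm_setU1 F i : i \notin F -> mnm_set (i |: F) = (U_(i) + mnm_set F)%MM.
Proof.
move=> iF; apply/mnmP => j; rewrite mnmDE mnm1E !mnmE !inE eq_sym.
by case: (i =P j) => [<-|_] //=; rewrite (negPf iF).
Qed.

Lemma mnm_set_sub Y F : Y \subset F ->
  mnm_set F = (mnm_set Y + mnm_set (F :\: Y))%MM.
Proof.
move=> /subsetP sub; apply/mnmP => i; rewrite mnmDE !mnmE inE.
by have := sub i; case: (i \in Y) => //= ->.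
Qed.

Lemma wt_off_mnm_set Y F : wt_off Y (mnm_set F) = #|F :\: Y|.
Proof.
rewrite /wt_off -sum1_card big_mkcond [RHS]big_mkcond /=.
by apply: eq_bigr => i _; rewrite inE mnmE; case: (i \notin Y); case: (i \in F).
Qed.

Section Degree.
Variable e : nat.
Hypothesis lt_en : (e < n)%N.

(** A squarefree monomial of degree e + 1 uses a variable outside any given set
    of e variables. *)
Lemma veronese_order Y f : #|Y| = e -> veronese K n e.+1 f -> order_ge Y 1 f.
Proof.
move=> cY; apply: ideal_gen_sub; first exact: order_ge_ideal.
move=> _ [u [sqf degu] <-]; apply/order_geX; rewrite lt0n.
apply/eqP => /eqP; rewrite /wt_off sum_nat_eq0 => /forallP u0.
suff : (mdeg u <= #|Y|)%N by rewrite degu cY ltnn.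
rewrite mdegE -sum1_card [leqRHS]big_mkcond /= leq_sum // => i _.
by have := u0 i; case: (i \in Y) => /= [_|/eqP ->].
Qed.

Lemma veronese_mem_set F : (e < #|F|)%N -> veronese K n e.+1 'X_[mnm_set F].
Proof.
move=> leF; have [||Y [_ sYF cY]] := @subset_between _ set0 F e.+1.
- exact: sub0set.
- by rewrite cards0.
rewrite (mnm_set_sub sYF) addmC mpolyXD; apply: ideal_gen_mull.
apply: ideal_gen_mem; exists (mnm_set Y) => //; split; last by rewrite mdeg_mnm_set.
by move=> i; rewrite mnmE; case: (i \in Y).
Qed.

(** A monomial outside I has its support in some set Y of e elements. *)
Lemma veronese_mem f :
  (forall Y, #|Y| = e -> order_ge Y 1 f) -> veronese K n e.+1 f.
Proof.
move=> of_; apply: ideal_of_monomials => [|u fu]; first exact: ideal_gen_is_ideal.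
pose F := [set i | (0 < u i)%N].
have leF : (mnm_set F <= u)%MM.
  by apply/mnm_lepP => i; rewrite mnmE inE; case: (u i).
rewrite -(submK leF) mpolyXD; apply: ideal_gen_mull; apply: veronese_mem_set.
rewrite ltnNge; apply/negP => leFe.
have [|Y [sFY _ cY]] := @subset_between _ F [set: 'I_n] e (subsetT _).
  by rewrite leFe cardsT card_ord ltnW.
have := of_ Y cY u fu; rewrite lt0n => /eqP; apply.
rewrite /wt_off big1 // => i iY; apply/eqP; rewrite -leqn0 leqNgt.
by apply: contra iY => ui; rewrite (subsetP sFY) // inE.
Qed.

(** For an associated prime P = I : f, let Z be the set of variables outside P.
    As P is prime, x_Z is not in P, that is, x_Z f is not in I; a set Y
    witnessing this contains Z, and P is the prime ideal that belongs to Y.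
    Conversely, the prime ideal that belongs to Y is I : x_Y. *)
Lemma Ass_veronese P : Ass (veronese K n e.+1) P <->
  exists2 Y : {set 'I_n}, #|Y| = e & P = order_ge Y 1.
Proof.
split=> [[[ [P0 P1 Plin] Pprime] [f defP]]|[Y cY ->]].
  pose Z := [set i | ('X_i : S) \notin P].
  have PZ : ('X_[mnm_set Z] : S) \notin P.
    suff : forall s : seq 'I_n, {subset s <= Z} ->
        (\prod_(i <- s) 'X_i : S) \notin P.
      move=> /(_ (enum Z)); rewrite big_enum mpolyXE_id => h.
      have -> : \prod_(i < n) ('X_i : S) ^+ (mnm_set Z i) = \prod_(i in Z) 'X_i.
        rewrite [RHS]big_mkcond; apply: eq_bigr => i _.
        by rewrite mnmE; case: ifP.
      by apply: h => i; rewrite mem_enum.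
    elim=> [|i s IHs] sub; first by rewrite big_nil.
    rewrite big_cons; apply/negP => /Pprime /orP[Pi|].
      by have := sub i (mem_head _ _); rewrite inE Pi.
    by apply/negP; apply: IHs => j js; rewrite sub // inE js orbT.
  have : ~ veronese K n e.+1 ('X_[mnm_set Z] * f).
    by move=> h; move: PZ; rewrite defP; apply/negP/negPn; rewrite in_setE.
  have [//|] := pselect (forall Y, #|Y| = e -> order_ge Y 1 ('X_[mnm_set Z] * f)).
    by move=> /veronese_mem.
  move=> /existsNP[Y /not_implyP[cY nY]] _; exists Y => //.
  have fY : ~ order_ge Y 1 f.
    by move=> h; apply: nY; rewrite -[1%N]add0n; apply: order_geM.
  have ZY : ~ order_ge Y 1 'X_[mnm_set Z].
    by move=> h; apply: nY; rewrite -[1%N]addn0; apply: order_geM.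
  apply/seteqP; split=> g.
    rewrite defP => /(veronese_order cY); exact: order_ge_cancel.
  move=> og; apply: ideal_of_monomials => [|u /og].
    split; first exact: set_mem.
    by move=> a x y /mem_set Px /mem_set Py; apply: set_mem; apply: Plin.
  move=> /wt_off_gt0[i iY le1].
  apply: set_mem; rewrite -(submK le1) mpolyXD -[_ * _]addr0.
  apply: Plin => //; apply: contraPT isT => Pi; case: ZY; apply/order_geX.
  rewrite wt_off_mnm_set card_gt0; apply/set0Pn; exists i.
  by rewrite !inE iY Pi.
split; first exact: order_ge_prime.
exists 'X_[mnm_set Y]; apply/seteqP; split=> g.
  move=> og; apply: ideal_of_monomials => [|u /og].
    by apply: colon_is_ideal; apply: ideal_gen_is_ideal.
  move=> /wt_off_gt0[i iY le1].
  rewrite /colon /= -(submK le1) mpolyXD -mulrA -mpolyXD -mnm_setU1 //.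
  by apply: ideal_gen_mull; apply: veronese_mem_set; rewrite cardsU1 iY cY.
move=> /(veronese_order cY); apply: order_ge_cancel.
by rewrite order_geX wt_off_mnm_set setDv cards0.
Qed.

Lemma ideal_pow_order Y k f : #|Y| = e ->
  ideal_pow (veronese K n e.+1) k f -> order_ge Y k f.
Proof.
move=> cY; elim: k f => [|k IHk] f; first by move=> _ u.
apply: ideal_gen_sub; first exact: order_ge_ideal.
move=> _ [a /(veronese_order cY) oa [b /IHk ob <-]].
by rewrite -add1n; apply: order_geM.
Qed.

(** Each of k variables of x^u outside Y combines with one factor x_Y to a
    generator of I. *)
Lemma ideal_pow_mem Y k u : #|Y| = e -> (k <= wt_off Y u)%N ->
  ideal_pow (veronese K n e.+1) k ('X_[mnm_set Y] ^+ k * 'X_[u]).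
Proof.
move=> cY; elim: k u => [//|k IHk] u le.
have [i iY le1] := wt_off_gt0 (leq_trans (ltn0Sn k) le).
rewrite -(submK le1) addmC; set v := (u - _)%MM.
have lev : (k <= wt_off Y v)%N.
  by move: le; rewrite -(submK le1) wt_offD wt_offU iY addn1.
apply: ideal_gen_mem; exists ('X_[mnm_set (i |: Y)]).
  by apply: veronese_mem_set; rewrite cardsU1 iY cY.
exists ('X_[mnm_set Y] ^+ k * 'X_[v]); first exact: IHk.
by rewrite mnm_setU1 // !mpolyXD exprS; ring.
Qed.

(** Multiplication by a power of x_Y, a unit in the localization at the prime
    ideal that belongs to Y, brings every f of sufficient order into I^k. *)
Lemma sym_pow_veronese k f : sym_pow (veronese K n e.+1) k f <->
  forall Y, #|Y| = e -> order_ge Y k f.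
Proof.
split=> [symf Y cY|of_ _ /Ass_veronese[Y cY ->]].
  have /symf[a [s [Ia Ps]]] : Ass (veronese K n e.+1) (order_ge Y 1).
    by apply/Ass_veronese; exists Y.
  have s0 : s != 0.
    by apply/eqP => s0; apply: Ps; rewrite s0; have [] := order_ge_ideal Y 1.
  have tf0 : tofrac s != 0 by rewrite tofrac_eq0.
  move=> /(congr1 (fun x => x * tofrac s)); rewrite divfK // -rmorphM /=.
  move=> /eqP; rewrite tofrac_eq => /eqP eqa.
  by apply: (order_ge_cancel Ps); rewrite eqa; apply: ideal_pow_order.
exists ('X_[mnm_set Y] ^+ k * f), ('X_[mnm_set Y] ^+ k); split.
- pose B : set S := fun g => ideal_pow (veronese K n e.+1) k ('X_[mnm_set Y] ^+ k * g).
  have idB : is_ideal (ideal_pow (veronese K n e.+1) k).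
    by case: (k) => [|k']; [split|apply: ideal_gen_is_ideal].
  apply: (@ideal_of_monomials B f).
    case: idB => B0 Blin; split=> [|a x y Bx By]; first by rewrite /B mulr0.
    by rewrite /B mulrDr mulrCA; apply: Blin.
  by move=> u /(of_ _ cY); apply: ideal_pow_mem.
- rewrite mpolyXn order_geX /wt_off big1 // => i iY.
  by rewrite mulmnE mnmE (negPf iY).
- by rewrite rmorphM /= mulrC mulKf // tofrac_eq0 expf_neq0 // -msupp_eq0 msuppX.
Qed.

End Degree.
End SymbolicPowersOfVeronese.

(** * Generators of the symbolic Rees algebra *)

Section Generators.
Variables (K : fieldType) (n e : nat).
Hypothesis lt_en : (e < n)%N.
Notation S := {mpoly K[n]}.
Implicit Types (u v : 'X_{1..n}) (Y F : {set 'I_n}).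

(** For e = 0 the ideal is the maximal ideal (x_1, ..., x_n), and only the x_i t
    are minimal generators. *)
Definition gen_card_max : nat := if e == 0%N then 1%N else n.

Notation gen_set := (sized e.+1 gen_card_max).

Definition gen_mon F : 'X_{1..n} * nat := (mnm_set F, (#|F| - e)%N).

Definition gens : set ('X_{1..n} * nat) :=
  [set gen_mon F | F in [set F : {set 'I_n} | gen_set F]]%classic.

(** By [sym_pow_veronese], the monomials x^u t^k of the symbolic Rees algebra. *)
Definition symbolic (a : 'X_{1..n} * nat) : Prop :=
  forall Y, #|Y| = e -> (a.2 <= wt_off Y a.1)%N.

Lemma symbolicD a b : symbolic a -> symbolic b ->
  symbolic ((a.1 + b.1)%MM, (a.2 + b.2)%N).
Proof. by move=> sa sb Y cY; rewrite wt_offD leq_add ?sa ?sb. Qed.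

Lemma symbolic_gen F : symbolic (gen_mon F).
Proof.
move=> Y cY; rewrite wt_off_mnm_set leq_subLR -cY -(cardsID Y F) leq_add2r.
by rewrite subset_leq_card ?subsetIr.
Qed.

Definition mnm_supp u : {set 'I_n} := [set i | (0 < u i)%N].

Lemma mnm_set_supp_le u F : F \subset mnm_supp u -> (mnm_set F <= u)%MM.
Proof.
move=> /subsetP sub; apply/mnm_lepP => i; rewrite mnmE.
by have := sub i; rewrite inE; case: (i \in F) => // ->.
Qed.

Lemma wt_off_supp Y u : mnm_supp u \subset Y -> wt_off Y u = 0%N.
Proof.
move=> /subsetP sub; rewrite /wt_off big1 // => i; have := sub i.
by rewrite inE; case: (u i) => // k ->.
Qed.

Lemma symbolic_card_supp u k : symbolic (u, k.+1) -> (e < #|mnm_supp u|)%N.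
Proof.
move=> sym; rewrite ltnNge; apply/negP => le.
case: (@subset_between _ (mnm_supp u) [set: 'I_n] e (subsetT _)).
  by rewrite le cardsT card_ord ltnW.
by move=> Y [sub _ cY]; have := sym Y cY; rewrite wt_off_supp.
Qed.

(** If |F - Y| is at most |F| - e for F the support of u, dividing by x_F costs no
    more than |F| - e off Y. Otherwise Y has an element j outside F, and exchanging
    it for some i in F - Y can only lower the degree off Y, since x_j does not
    occur: the claim for Y follows from the claim for the new set. *)
Lemma symbolic_sub_supp u k : symbolic (u, k.+1) ->
  symbolic ((u - mnm_set (mnm_supp u))%MM, (k.+1 - (#|mnm_supp u| - e))%N).
Proof.
move=> sym; have ltF := symbolic_card_supp sym; set F := mnm_supp u in ltF *.
set v := (u - _)%MM; set q := (#|F| - e)%N.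
have defu : u = (v + mnm_set F)%MM by rewrite submK // mnm_set_supp_le.
have v0 j : j \notin F -> v j = 0%N.
  by rewrite inE /v mnmBE mnmE; case: (u j).
move=> Y; move: {2}#|_|.+1 (ltnSn #|F :\: Y|) => c.
elim: c Y => // c IHc Y ltc cY; rewrite /=.
have [leq|ltq] := leqP #|F :\: Y| q.
  have := sym Y cY; rewrite /= {1}defu wt_offD wt_off_mnm_set.
  by move: leq; clear; lia.
have cFY := cardsID Y F; have cYF := cardsID F Y.
have [i iFY] : exists i, i \in F :\: Y.
  by apply/card_gt0P; apply: leq_ltn_trans ltq.
have [j jYF] : exists j, j \in Y :\: F.
  apply/card_gt0P; move: cFY cYF ltq ltF; rewrite setIC cY /q; clear; lia.
move: (iFY) (jYF); rewrite !in_setD => /andP[iY iF] /andP[jF jY].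
have neq_ij : i != j by apply: contraNneq iY => ->.
pose Y' := i |: Y :\ j.
have cY' : #|Y'| = e.
  by rewrite cardsU1 !inE (negPf iY) andbF -cY (cardsD1 j Y) jY.
apply: leq_trans (IHc Y' _ cY') _.
  have -> : F :\: Y' = (F :\: Y) :\ i.
    apply/setP => x; rewrite !(in_setD, in_setU1, in_set1).
    have [->|] := eqVneq x i => //=.
    by have [->|] := eqVneq x j => //=; rewrite (negPf jF) !andbF.
  by move: ltc; rewrite (cardsD1 i) iFY.
rewrite /wt_off /= big_mkcond [leqRHS]big_mkcond leq_sum //= => x _.
rewrite !(in_setU1, in_setD, in_set1); have [->|] := eqVneq x i => //=.
by have [->|] := eqVneq x j => //=; rewrite v0.
Qed.

(** The generator taken off is the full support, cut down to e + k + 1 elements if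
    it is too large for the exponent of t; for e = 0 a single variable. *)
Lemma symbolic_peel u k : symbolic (u, k.+1) ->
  exists F, [/\ gen_set F, (mnm_set F <= u)%MM, (#|F| - e <= k.+1)%N &
    symbolic ((u - mnm_set F)%MM, (k.+1 - (#|F| - e))%N)].
Proof.
move=> sym; have ltF := symbolic_card_supp sym.
have gen_setE F : (e < #|F|)%N -> (e = 0%N -> #|F| = 1%N) -> gen_set F.
  move=> lt1 eq1; rewrite /sized lt1 /gen_card_max; case: eqP => [/eq1->//|_].
  by rewrite -[leqRHS]card_ord max_card.
have [e0|e0] := eqVneq e 0%N.
  have [i iu] : exists i, i \in mnm_supp u by apply/card_gt0P; rewrite -e0 in ltF *.
  have le1 : (mnm_set [set i] <= u)%MM by apply: mnm_set_supp_le; rewrite sub1set.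
  exists [set i]; split=> //.
  - by apply: gen_setE; rewrite cards1 ?e0.
  - by rewrite cards1 e0.
  - move=> Y cY; have := sym Y cY; rewrite /= -{1}(submK le1) wt_offD.
    rewrite wt_off_mnm_set cards1 e0.
    have : (#|[set i] :\: Y| <= 1)%N by rewrite -(cards1 i) subset_leq_card ?subsetDl.
    by clear; lia.
have [leq|ltq] := leqP (#|mnm_supp u| - e)%N k.+1.
  exists (mnm_supp u); split=> //.
  - by apply: gen_setE => // /eqP; rewrite (negPf e0).
  - exact: mnm_set_supp_le.
  - exact: symbolic_sub_supp.
have [|F [_ sF cF]] := @subset_between _ set0 (mnm_supp u) (e + k.+1)%N (sub0set _).
  by rewrite cards0; move: ltq; clear; lia.
exists F; split.
- by apply: gen_setE => [|/eqP]; rewrite ?(negPf e0) // cF; clear; lia.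
- exact: mnm_set_supp_le.
- by rewrite cF addKn.
- by move=> Y _; rewrite cF addKn subnn.
Qed.

Lemma subalg_genM (G : set {poly S}) x y :
  subalg_gen G x -> subalg_gen G y -> subalg_gen G (x * y).
Proof.
move=> Gx Gy B BG; case: (BG) => -[_ _ BM] _.
by apply: set_mem; apply: BM; apply: mem_set; [apply: Gx|apply: Gy].
Qed.

Lemma subalg_genZD (G : set {poly S}) (r : S) x y :
  subalg_gen G x -> subalg_gen G y -> subalg_gen G (r *: x + y).
Proof.
move=> Gx Gy B BG; case: (BG) => -[_ BL _] _.
by apply: set_mem; apply: BL; apply: mem_set; [apply: Gx|apply: Gy].
Qed.

Lemma subalg_gen1 (G : set {poly S}) : subalg_gen G 1.
Proof. by move=> B [[B1 _ _] _]; apply: set_mem. Qed.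

Lemma subalg_gen0 (G : set {poly S}) : subalg_gen G 0.
Proof.
by have := subalg_genZD (-1) (@subalg_gen1 G) (@subalg_gen1 G); rewrite scaleN1r addNr.
Qed.

Lemma subalg_gen_mem (G : set {poly S}) x : G x -> subalg_gen G x.
Proof. by move=> Gx B [_]; apply. Qed.

Notation gen_alg := (subalg_gen (@tmon K n @` gens)%classic).

Lemma gen_alg_symbolic u k : symbolic (u, k) -> gen_alg (tmon K (u, k)).
Proof.
elim/ltn_ind: k u => -[|k] IHk u sym.
  rewrite /tmon /= expr0 -[_ *: _]addr0.
  by apply: subalg_genZD; [apply: subalg_gen1|apply: subalg_gen0].
have [F [gF leF leq symF]] := symbolic_peel sym.
rewrite -(submK leF) -(subnK leq).
have -> v w p q : tmon K ((v + w)%MM, (p + q)%N) = tmon K (v, p) * tmon K (w, q).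
  by rewrite /tmon /= mpolyXD exprD -scalerAl -scalerAr scalerA.
apply: subalg_genM; last by apply: subalg_gen_mem; exists (gen_mon F) => //; exists F.
apply: IHk => //; have /andP[ltF _] := gF.
by move: ltF; clear; lia.
Qed.

Lemma gen_alg_support (H : {poly S}) u k :
  gen_alg H -> (H`_k)@_u != 0 -> symbolic (u, k).
Proof.
move=> genH; apply: (subalg_gen_support (M := symbolic) _ _ _ genH) => //.
  exact: symbolicD.
by move=> _ [F _ <-]; apply: symbolic_gen.
Qed.

Lemma mcoeff_tmon (a : 'X_{1..n} * nat) : (tmon K a)`_(a.2)@_(a.1) = 1.
Proof. by rewrite /tmon coefZ coefXn eqxx mulr1 mcoeffX eqxx. Qed.

Lemma sym_rees_veronese : sym_rees (veronese K n e.+1) = gen_alg.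
Proof.
apply/seteqP; split=> H.
  move=> symH; rewrite -[H]coefK poly_def.
  elim: (size H) => [|k IHk]; first by rewrite big_ord0; apply: subalg_gen0.
  rewrite big_ord_recr /= addrC.
  suff gk : gen_alg (H`_k *: 'X^k).
    by rewrite -[_ *: _]scale1r; apply: subalg_genZD.
  have := symH k; move/(sym_pow_veronese lt_en) => ofk.
  pose B : set S := fun f => gen_alg (f *: 'X^k).
  apply: (@ideal_of_monomials _ _ B).
    split; first by rewrite /B scale0r; apply: subalg_gen0.
    by move=> a f g Bf Bg; rewrite /B scalerDl -scalerA; apply: subalg_genZD.
  move=> u nz; apply: (@gen_alg_symbolic u k) => Y cY; exact: (ofk Y cY u).
move=> genH k; apply/(sym_pow_veronese lt_en) => Y cY u nz.
exact: (gen_alg_support genH nz).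
Qed.

(** Choosing Y inside the support of u removes e from the degree. *)
Lemma symbolic_sqfree u k : (forall i, (u i <= 1)%N) -> symbolic (u, k.+1) ->
  (e + k.+1 <= mdeg u)%N.
Proof.
move=> sqf sym; have ltF := symbolic_card_supp sym.
have [|Y [_ sY cY]] := @subset_between _ set0 (mnm_supp u) e (sub0set _).
  by rewrite cards0 /= ltnW.
have defu : u = mnm_set (mnm_supp u).
  by apply/mnmP => i; rewrite mnmE inE; have := sqf i; case: (u i) => [|[]].
have := sym Y cY; rewrite /= {1}defu wt_off_mnm_set cardsDS // cY.
have -> : mdeg u = #|mnm_supp u| by rewrite {1}defu mdeg_mnm_set.
by move: ltF; clear; lia.
Qed.

(** Two factors of positive t-degrees k and l would have degrees at least e + k
    and e + l, which add up to more than the degree e + k + l of x_F unless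
    e = 0; in that case F is a singleton, and k + l = 1. *)
Lemma gen_irreducible F a b : gen_set F -> symbolic a -> symbolic b ->
  gen_mon F = ((a.1 + b.1)%MM, (a.2 + b.2)%N) ->
  b = gen_mon F \/ a = gen_mon F.
Proof.
move=> gF; case: a b => [u k] [v l] /= su sv; rewrite /gen_mon => def.
have /= defF := congr1 fst def; have /= defk := congr1 snd def; clear def.
have degF : (mdeg u + mdeg v)%N = #|F| by rewrite -mdegD -defF mdeg_mnm_set.
have /andP[ltF leF] := gF.
set c := #|_| in degF defk; rewrite -/c in ltF leF.
have sq i : (u i + v i <= 1)%N.
  by have := congr1 (fun x : 'X_{1..n} => x i) defF; rewrite mnmDE mnmE => <-;
     case: (i \in F).
have squ i : (u i <= 1)%N by rewrite (leq_trans _ (sq i)) ?leq_addr.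
have sqv i : (v i <= 1)%N by rewrite (leq_trans _ (sq i)) ?leq_addl.
case: k su defk => [|k] su defk.
  left; case: l sv defk => [|l] sv defk; first by move: defk ltF; clear; lia.
  have := symbolic_sqfree sqv sv; move=> le; rewrite defF defk.
  have : mdeg u == 0%N by move: le degF defk ltF; clear; lia.
  by rewrite mdeg_eq0 => /eqP ->; rewrite add0m.
have leu := symbolic_sqfree squ su.
case: l sv defk => [|l] sv defk.
  right; rewrite defF defk addn0.
  have : mdeg v == 0%N by move: leu degF defk ltF; clear; lia.
  by rewrite mdeg_eq0 => /eqP ->; rewrite addm0.
have lev := symbolic_sqfree sqv sv.
move: leF leu lev degF defk ltF; rewrite /gen_card_max; case: eqP => [->|]; clear; lia.
Qed.

(** If W misses a generator w0, the monomials of the algebra other than w0 still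
    form a monoid, by irreducibility, so that W cannot produce w0. *)
Lemma min_mon_alg_gens_veronese W :
  min_mon_alg_gens (sym_rees (veronese K n e.+1)) W -> W = gens.
Proof.
rewrite sym_rees_veronese => -[genW minW]; apply/esym/minW => // w0 gw0.
apply: contrapT => nw0.
pose M : set ('X_{1..n} * nat) := fun a => symbolic a /\ a <> w0.
have supp a : gen_alg (tmon K a) -> symbolic a.
  move=> ga; suff : symbolic (a.1, a.2) by rewrite -surjective_pairing.
  apply: (gen_alg_support ga).
  by rewrite mcoeff_tmon oner_eq0.
have [F gF defF] := gw0.
have gen0 : gen_alg (tmon K w0) by apply: subalg_gen_mem; exists w0.
rewrite -genW in gen0.
suff [] : M (w0.1, w0.2) by rewrite -surjective_pairing.
apply: (subalg_gen_support (M := M) _ _ _ gen0).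
- move=> u; split=> // defw; have := congr1 snd defw; rewrite -defF /=.
  by have /andP[ltF _] := gF; move=> /esym/eqP; rewrite subn_eq0 leqNgt ltF.
- move=> a b [sa na] [sb nb]; split; first exact: symbolicD.
  move=> defw; rewrite -defF in defw na nb.
  by have [] := gen_irreducible gF sa sb (esym defw).
- move=> a Wa; split; last by move=> eqa; apply: nw0; rewrite -eqa.
  by apply: supp; rewrite -genW; apply: subalg_gen_mem; exists a.
- by rewrite mcoeff_tmon oner_eq0.
Qed.

End Generators.

(** * The initial ideal of the toric kernel *)

Section BelowOrder.
Variable n : nat.
Implicit Types (A B : {set 'I_n}).

Lemma below_asym A B : below val B A -> below val A B = false.
Proof.
move=> ltBA; apply/negP => ltAB; move: ltBA ltAB; rewrite /below.
case: ltngtP => //= eqc /existsP[x /and3P[xA xB /forallP agx]].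
move=> /existsP[y /and3P[yB yA /forallP agy]].
have [lt_xy|lt_yx|/val_inj eq_xy] := ltngtP (val x) (val y).
- by have := agy x; rewrite lt_xy xA (negPf xB).
- by have := agx y; rewrite lt_yx yB (negPf yA).
- by move: xB; rewrite eq_xy yB.
Qed.

Lemma tmon_gt_gen_mon e A B : (e < #|A|)%N -> (e < #|B|)%N ->
  tmon_gt (gen_mon e A) (gen_mon e B) = below val B A.
Proof.
move=> ltA ltB; rewrite /tmon_gt /below /= (ltn_sub2rE _ (ltnW ltB)).
congr (_ || _); rewrite (eqn_sub2rE (ltnW ltA) (ltnW ltB)) eq_sym; congr (_ && _).
rewrite /lex_gt; apply: eq_existsb => x; rewrite !mnmE.
rewrite andbA; congr (_ && _); first by case: (x \in A); case: (x \in B).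
apply: eq_forallb => y; rewrite !mnmE.
by case: (y \in A); case: (y \in B).
Qed.

End BelowOrder.

Section ToricKernel.
Variables (K : fieldType) (n m : nat) (w : 'I_m -> 'X_{1..n} * nat).
Notation S := {mpoly K[n]}.
Notation T := {mpoly {mpoly K[n]}[m]}.
Implicit Types (g h : 'X_{1..m}) (f : 'X_{1..n}) (a b c : 'X_{1..m} * 'X_{1..n}).

Definition xdeg g : 'X_{1..n} := (\sum_i (w i).1 *+ g i)%MM.

Definition tdeg g : nat := (\sum_i (w i).2 * g i)%N.

Lemma xdegD g h : xdeg (g + h)%MM = (xdeg g + xdeg h)%MM.
Proof.
rewrite /xdeg -big_split /=; apply: eq_bigr => i _; apply/mnmP => j.
by rewrite !(mulmnE, mnmDE) mulnDr.
Qed.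

Lemma tdegD g h : tdeg (g + h)%MM = (tdeg g + tdeg h)%N.
Proof.
by rewrite /tdeg -big_split /=; apply: eq_bigr => i _; rewrite mnmDE mulnDr.
Qed.

Lemma xdegU i : xdeg U_(i)%MM = (w i).1.
Proof.
apply/mnmP => x; rewrite /xdeg mnm_sumE (bigD1 i) //= mulmnE mnm1E eqxx muln1.
by rewrite big1 ?addn0 // => j /negPf ne; rewrite mulmnE mnm1E eq_sym ne muln0.
Qed.

Lemma tdegU i : tdeg U_(i)%MM = (w i).2.
Proof.
rewrite /tdeg (bigD1 i) //= mnm1E eqxx muln1 big1 ?addn0 // => j /negPf ne.
by rewrite mnm1E eq_sym ne muln0.
Qed.

Lemma mmap1_tmon g : mmap1 (fun i => tmon K (w i)) g = tmon K (xdeg g, tdeg g).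
Proof.
rewrite /mmap1 /tmon /= /xdeg /tdeg.
rewrite (big_morph _ (@mpolyXD n K) (@mpolyX0 n K)) -prodrXr -scaler_prod.
apply: eq_bigr => i _.
by rewrite exprZn mpolyXn -exprM.
Qed.

Lemma phiE (p : T) : phi w p = \sum_(g <- msupp p) p@_g *: tmon K (xdeg g, tdeg g).
Proof.
by rewrite /phi /mmap; apply: eq_bigr => g _; rewrite mmap1_tmon mul_polyC.
Qed.

Lemma mcoeff_term (q : S) g f k :
  (((q *: tmon K (xdeg g, tdeg g))`_k)@_f != 0) ->
  exists f', [/\ q@_f' != 0, f = (f' + xdeg g)%MM & k = tdeg g].
Proof.
rewrite /tmon /= !coefZ coefXn; case: (k =P tdeg g) => [->|_]; last first.
  by rewrite !mulr0 mcoeff0 eqxx.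
rewrite mulr1 => /msupp_mul_split[f' [f'' [q0 x0 ->]]]; exists f'; split=> //.
by move: x0; rewrite mcoeffX; case: (xdeg g =P f'') => [->|_] //; rewrite eqxx.
Qed.

Lemma phi_Tmon a : phi w (Tmon K a) = tmon K ((a.2 + xdeg a.1)%MM, tdeg a.1).
Proof.
rewrite phiE /Tmon.
have nzX : ('X_[a.2] : S) != 0 by rewrite -msupp_eq0 msuppX.
rewrite (msuppMCX a.1 nzX) big_seq1 mcoeffZ mcoeffX eqxx mulr1.
by rewrite /tmon /= scalerA mpolyXD.
Qed.

(** The term of p at a has to cancel against another one with the same image. *)
Lemma kernel_cancel (p : T) a : phi w p = 0 -> Tcoeff p a != 0 ->
  exists b, [/\ b != a, Tcoeff p b != 0,
    (a.2 + xdeg a.1 = b.2 + xdeg b.1)%MM & tdeg a.1 = tdeg b.1].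
Proof.
move=> p0 pa; apply: contrapT => none.
set f := (a.2 + xdeg a.1)%MM; set k := tdeg a.1.
have a1p : a.1 \in msupp p.
  by rewrite mcoeff_msupp; apply: contraNneq pa => e0; rewrite /Tcoeff e0 mcoeff0.
have : ((phi w p)`_k)@_f = 0 by rewrite p0 coef0 mcoeff0.
rewrite phiE coef_sum raddf_sum /= (bigD1_seq a.1) //= big1_seq ?addr0; last first.
  move=> g /andP[ga _]; apply/eqP/negPn/negP => /mcoeff_term[f' [nz eqf eqk]].
  apply: none; exists (g, f'); split=> //.
  by apply: contraNneq ga => <-.
rewrite /tmon /= !coefZ coefXn eqxx mulr1 /f addmC mcoeffMX.
by move/eqP; rewrite (negPf pa).
Qed.

Lemma binomial_initial a b : degrevlex_gt a.1 b.1 ->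
  (a.2 + xdeg a.1 = b.2 + xdeg b.1)%MM -> tdeg a.1 = tdeg b.1 ->
  initial_ideal (rees_ker w) (Tmon K a).
Proof.
move=> gt_ab eqx eqt.
have neq_ab : b != a.
  apply: contraTneq gt_ab => ->; rewrite /degrevlex_gt ltnn eqxx /=.
  by apply/existsP => -[i]; rewrite ltnn.
apply: ideal_gen_mem; exists a => //; exists (Tmon K a - Tmon K b).
  by rewrite /rees_ker /= {1}/phi mmapB -!/(phi w _) !phi_Tmon eqx eqt subrr.
split=> [|c].
  by rewrite TcoeffB !Tcoeff_Tmon eqxx (negPf neq_ab) subr0 oner_eq0.
rewrite TcoeffB !Tcoeff_Tmon => nz neq_ca; move: nz;
rewrite [a == c]eq_sym (negPf neq_ca).
case: (b =P c) => [<- _|_]; last by rewrite subr0 eqxx.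
by rewrite /Tmon_gt gt_ab.
Qed.

Lemma degrevlex_gt_add2l P g h :
  degrevlex_gt (P + g)%MM (P + h)%MM = degrevlex_gt g h.
Proof.
rewrite /degrevlex_gt !mdegD ltn_add2l eqn_add2l; congr (_ || (_ && _)).
apply: eq_existsb => i; rewrite !mnmDE ltn_add2l; congr (_ && _).
by apply: eq_forallb => j; rewrite !mnmDE eqn_add2l.
Qed.

(** The x-part of the smaller monomial is determined by g and the common image, so
    that only divisibility has to be recorded. *)
Lemma initial_nonstandard a : initial_ideal (rees_ker w) (Tmon K a) ->
  exists g, [/\ degrevlex_gt a.1 g, (xdeg g <= a.2 + xdeg a.1)%MM &
    tdeg g = tdeg a.1].
Proof.
move=> /ideal_gen_Tmon_divisor[c [[p Jp [pc inic]] le1 le2]].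
have [b [neq_bc pb eqx eqt]] := kernel_cancel Jp pc.
have := inic b pb neq_bc; rewrite /Tmon_gt => /orP[gt_cb|]; last first.
  move=> /andP[/eqP eq1 _]; case/eqP: neq_bc; case: b c eq1 eqx {pb pc inic le1 le2 eqt}.
  by move=> b1 b2 [c1 c2] /= -> /addIm ->.
exists ((a.1 - c.1) + b.1)%MM; split.
- by rewrite -{1}(submK le1) degrevlex_gt_add2l.
- have -> : xdeg a.1 = (xdeg (a.1 - c.1) + xdeg c.1)%MM by rewrite -xdegD submK.
  rewrite xdegD.
  apply/mnm_lepP => i; rewrite !mnmDE.
  have /(congr1 (fun f : 'X_{1..n} => f i)) := eqx; rewrite !mnmDE => eqi.
  have /mnm_lepP/(_ i) := le2; move: eqi; clear; lia.
- by rewrite tdegD -eqt -tdegD submK.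
Qed.

End ToricKernel.

(** * Reduction to one variable *)

Lemma mnm_supp_set n (F : {set 'I_n}) : mnm_supp (mnm_set F) = F.
Proof. by apply/setP => i; rewrite inE mnmE; case: (i \in F). Qed.

Section SetIndices.
Variables (n e m : nat) (w : 'I_m -> 'X_{1..n} * nat).
Hypothesis w_range : range w = @gens n e.
Hypothesis w_sorted : forall i j : 'I_m, (i < j)%N -> tmon_gt (w i) (w j).
Implicit Types (F : {set 'I_n}) (s t : seq 'I_m) (g h : 'X_{1..m}).

Notation gen_set := (sized e.+1 (gen_card_max n e)).

Definition gen_support (i : 'I_m) : {set 'I_n} := mnm_supp (w i).1.

(** Monomials in the y's as products over lists of indices, to which the results on
    lists of sets apply through [gen_support]. *)
Definition mnm_of_seq s : 'X_{1..m} := (\sum_(i <- s) U_(i))%MM.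

Lemma gen_supportP i : gen_set (gen_support i) /\ w i = gen_mon e (gen_support i).
Proof.
have : range w (w i) by exists i.
by rewrite w_range => -[F gF defF]; rewrite /gen_support -defF mnm_supp_set.
Qed.

Lemma all_gen_support s : all gen_set (map gen_support s).
Proof. by apply/allP => _ /mapP[i _ ->]; have [] := gen_supportP i. Qed.

Lemma gen_support_gt i : (e < #|gen_support i|)%N.
Proof. by have [/andP[]] := gen_supportP i. Qed.

Lemma gen_support_surj F : gen_set F -> exists i, gen_support i = F.
Proof.
move=> gF; have : @gens n e (gen_mon e F) by exists F.
by rewrite -w_range => -[i _ defF]; exists i; rewrite /gen_support defF mnm_supp_set.
Qed.

Lemma gen_supports_surj (s : seq {set 'I_n}) : all gen_set s ->
  exists t, map gen_support t = s.
Proof.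
elim: s => [|F s IHs]; first by exists [::].
by move=> /= /andP[/gen_support_surj[i <-] /IHs[t <-]]; exists (i :: t).
Qed.

Lemma below_gen_support i j :
  below val (gen_support i) (gen_support j) = (j < i)%N.
Proof.
have below_lt (k l : 'I_m) : (k < l)%N -> below val (gen_support l) (gen_support k).
  move=> /w_sorted; rewrite (gen_supportP k).2 (gen_supportP l).2.
  by rewrite tmon_gt_gen_mon ?gen_support_gt.
case: ltngtP => [/below_lt//|/below_lt/below_asym//|/val_inj ->].
by apply/negP => lt; have := below_asym lt; rewrite lt.
Qed.

Lemma mnm_of_seq_cons i s : mnm_of_seq (i :: s) = (U_(i) + mnm_of_seq s)%MM.
Proof. by rewrite /mnm_of_seq big_cons. Qed.

Lemma mnm_of_seq_surj g : exists s, mnm_of_seq s = g.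
Proof.
elim: {g}(mdeg g) {-2}g (erefl (mdeg g)) => [|k IHk] g degg.
  by exists [::]; move/eqP: degg; rewrite mdeg_eq0 /mnm_of_seq big_nil => /eqP ->.
have [|i gi] := @mdeg_gt0_ex _ g; first by rewrite degg.
have [R defg] := mnm_sub1 gi.
have [|s defR] := IHk R; first by move: degg; rewrite defg mdegD mdeg1 => -[].
by exists (i :: s); rewrite mnm_of_seq_cons defR defg.
Qed.

Lemma mdeg_mnm_of_seq s : mdeg (mnm_of_seq s) = size s.
Proof.
elim: s => [|i s IHs]; first by rewrite /mnm_of_seq big_nil mdeg0.
by rewrite mnm_of_seq_cons mdegD mdeg1 IHs.
Qed.

Lemma mnm_of_seq_gt0 s i : (0 < mnm_of_seq s i)%N = (i \in s).
Proof.
elim: s => [|j s IHs]; first by rewrite /mnm_of_seq big_nil mnm0E.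
by rewrite mnm_of_seq_cons mnmDE mnm1E inE addn_gt0 IHs lt0b eq_sym.
Qed.

Lemma xdeg_mnm_of_seq s x :
  xdeg w (mnm_of_seq s) x = cover_count (map gen_support s) x.
Proof.
elim: s => [|i s IHs].
  rewrite /mnm_of_seq big_nil /xdeg mnm_sumE big1 // => j _.
  by rewrite mnm0E mulm0n mnm0E.
rewrite mnm_of_seq_cons xdegD mnmDE IHs xdegU (gen_supportP i).2 mnmE.
by rewrite /cover_count.
Qed.

Lemma tdeg_mnm_of_seq s :
  (tdeg w (mnm_of_seq s) + size s * e)%N = total_card (map gen_support s).
Proof.
elim: s => [|i s IHs].
  by rewrite /mnm_of_seq /total_card !big_nil /tdeg big1 // => j _; rewrite mnm0E muln0.
rewrite mnm_of_seq_cons tdegD tdegU /total_card big_cons -/(total_card _) -IHs.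
rewrite {1}(gen_supportP i).2 /= mulSn addnACA subnK //.
by rewrite ltnW ?gen_support_gt.
Qed.

(** If f together with g admits a smaller monomial g', a single variable of f does.
    A smaller degree is impossible for e = 0, where the t-degree is the number of
    factors. *)
Lemma degrevlex_improve g g' (f : 'X_{1..n}) (i0 : 'I_n) :
  (0 < f i0)%N -> degrevlex_gt g g' ->
  (xdeg w g' <= f + xdeg w g)%MM -> tdeg w g' = tdeg w g ->
  exists h i, [/\ (0 < f i)%N, degrevlex_gt g h,
    (xdeg w h <= U_(i) + xdeg w g)%MM & tdeg w h = tdeg w g].
Proof.
move=> fi0 gt_gg' le_x eq_t.
have [lt_deg|] := boolP (mdeg g' < mdeg g)%N.
  have [s defg] := mnm_of_seq_surj g; have [s' defg'] := mnm_of_seq_surj g'.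
  move: lt_deg; rewrite -defg -defg' !mdeg_mnm_of_seq => lt_size.
  have ts := tdeg_mnm_of_seq s; have ts' := tdeg_mnm_of_seq s'.
  rewrite defg in ts; rewrite defg' eq_t in ts'.
  have e0 : e <> 0%N.
    have tc t : e = 0%N -> total_card (map gen_support t) = size t.
      move=> e0; rewrite /total_card big_map -sum1_size; apply: eq_bigr => i _.
      have [/andP[lo hi] _] := gen_supportP i; move: lo hi.
      by rewrite /gen_card_max e0 /= => lo hi; apply/eqP; rewrite eqn_leq hi.
    move=> e0; move: ts ts' lt_size; rewrite !(tc _ e0) e0; clear; lia.
  have [||||Hs [i [fi lHs cmp eq_tot le_c]]] := @improve_length _ e
    (map gen_support s) (map gen_support s') f i0 fi0.
  - by apply/allP => _ /mapP[i _ ->]; apply: gen_support_gt.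
  - by rewrite !size_map.
  - by rewrite -ts -ts' !size_map; clear; lia.
  - move=> x; rewrite -!xdeg_mnm_of_seq defg defg'.
    by have /mnm_lepP/(_ x) := le_x; rewrite mnmDE addnC.
  have [t deft] : exists t, map gen_support t = Hs.
    apply: gen_supports_surj; apply/allP => H HHs.
    rewrite /sized (allP lHs H HHs) /gen_card_max; case: eqP => // _.
    by rewrite -[leqRHS]card_ord max_card.
  rewrite -deft !size_map in cmp eq_tot.
  exists (mnm_of_seq t), i; split=> //.
  - case: cmp => [lt|[eqs [H]]].
      by rewrite /degrevlex_gt !mdeg_mnm_of_seq lt.
    move=> /mapP[j jt ->] ltH.
    rewrite -[X in degrevlex_gt X]add0m -[X in degrevlex_gt _ X]add0m.
    apply: (@degrevlex_gt_addl _ _ _ _ j); rewrite ?mnm_of_seq_gt0 //.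
      by rewrite !mdeg_mnm_of_seq.
    move=> l; rewrite mnm_of_seq_gt0 => ls; rewrite -below_gen_support /below.
    by rewrite ltH ?map_f.
  - apply/mnm_lepP => x; rewrite mnmDE xdeg_mnm_of_seq deft defg mnm1E.
    have := le_c x; rewrite -!xdeg_mnm_of_seq defg addnC eq_sym; exact.
  - by move: eq_tot ts (tdeg_mnm_of_seq t); rewrite -defg; clear; lia.
move=> ge_deg; have eq_deg : mdeg g = mdeg g'.
  by move: gt_gg' ge_deg; rewrite /degrevlex_gt; case: ltngtP.
have [P [i [j [R [R' [defg defg' lt_ji suppR]]]]]] := degrevlex_gt_split gt_gg' eq_deg.
have [s defR] := mnm_of_seq_surj R; have [s' defR'] := mnm_of_seq_surj R'.
have [defX defY] : (U_(j) + R)%MM = mnm_of_seq (j :: s) /\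
    (U_(i) + R')%MM = mnm_of_seq (i :: s').
  by rewrite !mnm_of_seq_cons defR defR'.
rewrite defX in defg; rewrite defY in defg'.
have eq_size : size s' = size s.
  by move: eq_deg; rewrite defg defg' !mdegD !mdeg_mnm_of_seq => /addnI [].
have ext : gen_card_max n e = e.+1 \/ gen_card_max n e = #|'I_n|.
  by rewrite /gen_card_max card_ord; case: eqP => [->|]; [left|right].
case: (improve_head (rk := val) val_inj ext (A := gen_support j)
  (B := gen_support i) (Fs := map gen_support s) (Gs := map gen_support s')
  (b := f) fi0).
- exact: (all_gen_support (j :: s)).
- exact: (all_gen_support (i :: s')).
- by rewrite !size_map.
- by rewrite below_gen_support.
- have := tdeg_mnm_of_seq (i :: s'); have := tdeg_mnm_of_seq (j :: s).
  rewrite /= => <- <-; rewrite eq_size; congr (_ + _)%N.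
  by move: eq_t; rewrite defg defg' !tdegD => /addnI.
- move=> x; have := xdeg_mnm_of_seq (i :: s') x; have := xdeg_mnm_of_seq (j :: s) x.
  rewrite /= => <- <-; have /mnm_lepP/(_ x) := le_x; rewrite mnmDE defg defg'.
  by rewrite !xdegD !mnmDE; clear; lia.
move=> B' [Fs' [k [fk gB' sz' ltB' [tot' le_c]]]].
have [t deft] := gen_supports_surj gB'.
case: t deft => // i' t [defB' defFs'].
exists (P + mnm_of_seq (i' :: t))%MM, k; split=> //.
- rewrite defg; apply: (@degrevlex_gt_addl _ _ _ _ i').
  + by rewrite !mdeg_mnm_of_seq /=; move: sz'; rewrite -defFs' !size_map => ->.
  + by rewrite mnm_of_seq_gt0 mem_head.
  + move: ltB'; rewrite -defB' below_gen_support => lt_ji' l.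
    rewrite mnm_of_seq_gt0 inE => /orP[/eqP -> //|ls].
    by rewrite (leq_ltn_trans _ lt_ji') // suppR // -defR mnm_of_seq_gt0.
- apply/mnm_lepP => x; rewrite defg !xdegD !mnmDE mnm1E addnCA leq_add2l.
  rewrite !xdeg_mnm_of_seq /= defB' defFs' [leqRHS]addnC [k == x]eq_sym.
  exact: le_c.
- rewrite defg !tdegD; congr (_ + _)%N.
  have := tdeg_mnm_of_seq (i' :: t); have := tdeg_mnm_of_seq (j :: s).
  rewrite /= defB' defFs' tot' => <-.
  have -> : size t = size s by move: sz'; rewrite -defFs' !size_map.
  by move/addIn.
Qed.

End SetIndices.

(** A minimal generator whose x-part has degree at least 2 would be divisible by
    another member of the generating set, namely a divisor of g x_i. *)
Lemma x_condition_of_improve (K : fieldType) (n m : nat)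
    (w : 'I_m -> 'X_{1..n} * nat) :
  (forall g g' (f : 'X_{1..n}) (i0 : 'I_n), (0 < f i0)%N -> degrevlex_gt g g' ->
    (xdeg w g' <= f + xdeg w g)%MM -> tdeg w g' = tdeg w g ->
    exists h i, [/\ (0 < f i)%N, degrevlex_gt g h,
      (xdeg w h <= U_(i) + xdeg w g)%MM & tdeg w h = tdeg w g]) ->
  x_condition K w.
Proof.
move=> improve a [G [genG minG] Ga]; rewrite leqNgt; apply/negP => lt1.
have [|g' [gt_ag' le_x eq_t]] := @initial_nonstandard K n m w a.
  by rewrite -genG; apply: ideal_gen_mem; exists a.
have [i0 ai0] := mdeg_gt0_ex (ltnW lt1).
have [h [i [ai gt_ah le_h eq_h]]] := improve _ _ _ _ ai0 gt_ag' le_x eq_t.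
have : initial_ideal (rees_ker w) (Tmon K (a.1, U_(i)%MM)).
  apply: (binomial_initial (b := (h, (U_(i) + xdeg w a.1 - xdeg w h)%MM))) => //=.
  by rewrite submK.
rewrite -genG => /ideal_gen_Tmon_divisor[c [Gc /= le1 le2]].
have deg_c : (mdeg c.2 <= 1)%N.
  by rewrite -(mdeg1 i) -(submK le2) mdegD leq_addl.
have neq_ca : c <> a by move=> eq_ca; move: lt1; rewrite -eq_ca ltnNge deg_c.
have le2a : (c.2 <= a.2)%MM.
  apply: lepm_trans le2 _.
  by apply/mnm_lepP => j; rewrite mnm1E; case: eqP => // <-.
pose G' : set ('X_{1..m} * 'X_{1..n}) := fun b => G b /\ b <> a.
suff genG' : ideal_gen (@Tmon K n m @` G')%classic = initial_ideal (rees_ker w).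
  have eqG' : G' = G by apply: minG genG' => b [].
  by have [] : G' a by rewrite eqG'.
rewrite -genG; apply/seteqP; split=> x; apply: ideal_gen_sub;
  try exact: ideal_gen_is_ideal.
  by move=> _ [b [Gb _] <-]; apply: ideal_gen_mem; exists b.
move=> _ [b Gb <-]; have [->|neq_ba] := pselect (b = a).
  rewrite (Tmon_split K le1 le2a); apply: ideal_gen_mull.
  by apply: ideal_gen_mem; exists c.
by apply: ideal_gen_mem; exists b.
Qed.

Theorem theorem3p2 (K : fieldType) (n d : nat) (hd : (1 <= d <= n)%N)
    (m : nat) (w : 'I_m -> 'X_{1..n} * nat)
    (w_gens : min_mon_alg_gens (sym_rees (veronese K n d)) (range w))
    (w_sorted : forall i j : 'I_m, (i < j)%N -> tmon_gt (w i) (w j)) :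
  x_condition K w.
Proof.
case: d hd w_gens => // e lt_en w_gens.
have w_range := min_mon_alg_gens_veronese lt_en w_gens.
apply: x_condition_of_improve => g g' f i0.
exact: (degrevlex_improve w_range w_sorted).
Qed.
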